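(* Let $G$ be a discrete group. Then for every weight inverse $\omega$ on the dual of $G$, $\operatorname{spec}A(G,\omega)=G$, where $s\in G$ is identified with the element $\lambda(s)\omega\in\operatorname{spec}A(G,\omega)\subset VN(G)$ (equivalently, with the character $u\mapsto u(s)$ of $A(G,\omega)$); that is, $s\mapsto\lambda(s)\omega$ is a bijection of $G$ onto $\operatorname{spec}A(G,\omega)$.
   Context: $\lambda$ is the left regular representation of $G$ on $L^2(G)$, $VN(G)=\lambda(G)''$. $\Gamma:VN(G)\to VN(G)\bar\otimes VN(G)$ is the unique normal $*$-homomorphism with $\Gamma(\lambda(s))=\lambda(s)\otimes\lambda(s)$. A weight inverse on the dual of $G$ is an $\omega\in VN(G)$ with $\omega\omega^*\otimes\omega\omega^*\le\Gamma(\omega\omega^* )$ and $\ker\omega=\ker\omega^*=\{0\}$. Its associated $2$-cocycle is the unique $\Omega\in VN(G)\bar\otimes VN(G)$ with $\omega\otimes\omega=\Gamma(\omega)\Omega$. $A(G)$ is the Fourier algebra, the predual of $VN(G)$ with pairing $(T,u)=\langle T\xi,\eta\rangle$ for $u(s)=\langle\lambda(s)\xi,\eta\rangle$; $Tf\in A(G)$ is defined by $(R,Tf)=(RT,f)$ for $T,R\in VN(G)$, $f\in A(G)$. $A(G,\omega)=\omega A(G)\subset A(G)$ with pointwise multiplication and norm $\|\omega f\|_\omega=\|f\|_{A(G)}$ is a commutative Banach algebra; its Gelfand spectrum (set of nonzero characters) is identified with a subset of $VN(G)$, $\sigma$ corresponding to the character $\omega u\mapsto(\sigma,u)$; thus $\operatorname{spec}A(G,\omega)=\{\sigma\in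 VN(G):\sigma\ne0,\ \Gamma(\sigma)\Omega=\sigma\otimes\sigma\}$. *)

(* Defs.v *)
From HB Require Import structures.
From mathcomp Require Import all_boot all_order all_algebra complex ring lra.
From mathcomp Require Import all_classical all_reals all_analysis.

Set Implicit Arguments.
Unset Strict Implicit.
Unset Printing Implicit Defensive.

Import Order.TTheory GRing.Theory Num.Theory.

Local Open Scope classical_set_scope.
Local Open Scope ring_scope.

(* Unordered sums of absolutely summable families over an arbitrary (possibly
   uncountable) index type; the value is meaningless for other families. *)
Definition rsum (R : realType) (X : choiceType) (f : X -> R) : R :=
  fine (\esum_(x in [set: X]) (Num.max (f x) 0)%:E)
  - fine (\esum_(x in [set: X]) (Num.max (- f x) 0)%:E).

Definition csum (R : realType) (X : choiceType) (f : X -> R[i]) : R[i] :=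
  Complex (rsum (fun x => complex.Re (f x))) (rsum (fun x => complex.Im (f x))).

Lemma le_esumZ (R : realType) (X : choiceType) (k : R) (f : X -> R) :
  0 <= k -> (forall x, 0 <= f x) ->
  (\esum_(x in [set: X]) (k * f x)%:E <=
     k%:E * \esum_(x in [set: X]) (f x)%:E)%E.
Proof.
move=> k0 f0; apply: ge_ereal_sup => _ [A [finA AX] <-].
have -> : (\sum_(x \in A) (k * f x)%:E = k%:E * \sum_(x \in A) (f x)%:E)%E.
  by rewrite ge0_mule_fsumr// => x; rewrite lee_fin.
by rewrite lee_wpmul2l ?lee_fin// esum_ge//; exists A.
Qed.

Section SquareSummable.
Variable R : realType.

Definition abs2 (z : R[i]) : R := complex.Re z ^+ 2 + complex.Im z ^+ 2.

Lemma abs2_ge0 z : 0 <= abs2 z.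
Proof. by rewrite addr_ge0 ?sqr_ge0. Qed.

Lemma abs2M z w : abs2 (z * w) = abs2 z * abs2 w.
Proof. by case: z => a b; case: w => c d; rewrite /abs2 /=; ring. Qed.

Lemma abs2D z w : abs2 (z + w) <= 2 * abs2 z + 2 * abs2 w.
Proof.
case: z => a b; case: w => c d; rewrite /abs2 /=.
have := sqr_ge0 (a - c); have := sqr_ge0 (b - d); nra.
Qed.

Definition sqnorm (X : choiceType) (f : X -> R[i]) : \bar R :=
  \esum_(x in [set: X]) (abs2 (f x))%:E.

Definition sqsummable (X : choiceType) : {pred X -> R[i]} :=
  [pred f | (sqnorm f < +oo)%E].

Lemma sqsummable_submod (X : choiceType) : submod_closed (@sqsummable X).
Proof.
split=> [|a f g]; rewrite !inE /sqnorm.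
  by rewrite esum1// => x _; rewrite /abs2/= expr0n addr0.
move=> fX gX; pose k := 2 * abs2 a.
have k0 : 0 <= k by rewrite mulr_ge0 ?abs2_ge0.
apply: (@le_lt_trans _ _ (\esum_(x in [set: X]) (k * abs2 (f x))%:E +
    \esum_(x in [set: X]) (2 * abs2 (g x))%:E)%E).
  rewrite -esumD; first last.
  - by move=> x _; rewrite lee_fin mulr_ge0 ?abs2_ge0.
  - by move=> x _; rewrite lee_fin mulr_ge0 ?abs2_ge0.
  apply: le_esum => x _; rewrite -EFinD lee_fin (le_trans (abs2D _ _))//.
  by rewrite abs2M mulrA.
have fin (c : R) (h : X -> R[i]) : 0 <= c -> (sqnorm h < +oo)%E ->
    (\esum_(x in [set: X]) (c * abs2 (h x))%:E < +oo)%E.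
  move=> c0 hX; rewrite (le_lt_trans (le_esumZ c0 _))// => [x|].
    exact: abs2_ge0.
  by rewrite lte_mul_pinfty ?lee_fin.
by rewrite lte_add_pinfty// fin.
Qed.

HB.instance Definition _ (X : choiceType) :=
  GRing.isSubmodClosed.Build R[i] (X -> R[i]) (@sqsummable X)
    (sqsummable_submod X).

End SquareSummable.

Section l2.
Variable R : realType.

Record l2 (X : choiceType) : Type := L2 {
  l2fun :> X -> R[i]; l2P : l2fun \in @sqsummable R X }.

HB.instance Definition _ X := [isSub for @l2fun X].
HB.instance Definition _ X := [Choice of l2 X by <:].
HB.instance Definition _ X := [SubChoice_isSubLmodule of l2 X by <:].

Definition dot (X : choiceType) (xi eta : l2 X) : R[i] :=
  csum (fun x => xi x * conjc (eta x)).

Definition l2norm (X : choiceType) (xi : l2 X) : R :=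
  Num.sqrt (fine (sqnorm xi)).

Lemma tens_subproof (X Y : choiceType) (xi : l2 X) (eta : l2 Y) :
  (fun p : X * Y => xi p.1 * eta p.2) \in @sqsummable R (X * Y)%type.
Proof.
have := l2P eta; have := l2P xi; rewrite !inE /=.
move: (l2fun xi) (l2fun eta) => f g fX gY.
have gfin : sqnorm g \is a fin_num.
  by rewrite ge0_fin_numE// esum_ge0// => y _; rewrite lee_fin abs2_ge0.
have g0 : 0 <= fine (sqnorm g).
  by rewrite fine_ge0// esum_ge0// => y _; rewrite lee_fin abs2_ge0.
have -> : sqnorm (fun p : X * Y => f p.1 * g p.2) =
    \esum_(x in [set: X]) \esum_(y in [set: Y]) (abs2 (f x * g y))%:E.
  rewrite esum_esum /sqnorm => [|x y _ _]; last by rewrite lee_fin abs2_ge0.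
  by congr esum; apply/seteqP; split.
apply: (@le_lt_trans _ _
    (\esum_(x in [set: X]) (fine (sqnorm g) * abs2 (f x))%:E)).
  apply: le_esum => x _; under eq_esum do rewrite abs2M.
  rewrite (le_trans (le_esumZ (abs2_ge0 _) _))//; first by move=> y; exact: abs2_ge0.
  by rewrite EFinM fineK// muleC.
rewrite (le_lt_trans (le_esumZ g0 _))//; first by move=> x; exact: abs2_ge0.
by rewrite lte_mul_pinfty ?lee_fin.
Qed.

Definition tens (X Y : choiceType) (xi : l2 X) (eta : l2 Y) : l2 (X * Y)%type :=
  L2 (tens_subproof xi eta).

Definition operator (X : choiceType) := l2 X -> l2 X.

Definition bounded_operator (X : choiceType) (T : operator X) : Prop :=
  (forall (a : R[i]) (xi eta : l2 X), T (a *: xi + eta) = a *: T xi + T eta) /\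
  exists M : R, forall xi : l2 X, l2norm (T xi) <= M * l2norm xi.

(* The Hilbert space adjoint, for bounded T *)
Definition adj (X : choiceType) (T : operator X) : operator X :=
  xget (0 : operator X)
    [set S : operator X | forall xi eta : l2 X, dot (T xi) eta = dot xi (S eta)].

(* S (x) T on l^2(X) (x) l^2(Y) = l^2(X * Y), for bounded S and T *)
Definition tensop (X Y : choiceType) (S : operator X) (T : operator Y) :
    operator (X * Y)%type :=
  xget (0 : operator (X * Y)%type)
    [set U : operator (X * Y)%type | bounded_operator U /\
      forall (xi : l2 X) (eta : l2 Y), U (tens xi eta) = tens (S xi) (T eta)].

Definition op_le (X : choiceType) (S T : operator X) : Prop :=
  forall xi : l2 X, dot (S xi) xi <= dot (T xi) xi.

Definition op_inj (X : choiceType) (T : operator X) : Prop :=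
  forall xi : l2 X, T xi = 0 -> xi = 0.

Definition commutant (X : choiceType) (M : set (operator X)) :
    set (operator X) :=
  [set T | bounded_operator T /\ forall S, M S -> T \o S = S \o T].

(* Sigma-weakly continuous functionals on M *)
Definition normal_functional (X : choiceType) (M : set (operator X))
    (phi : operator X -> R[i]) : Prop :=
  exists xi eta : nat -> l2 X,
    [/\ (\esum_(n in [set: nat]) (l2norm (xi n) ^+ 2)%:E < +oo)%E,
        (\esum_(n in [set: nat]) (l2norm (eta n) ^+ 2)%:E < +oo)%E &
        forall T, M T -> phi T = csum (fun n => dot (T (xi n)) (eta n))].

Record normal_star_hom (X Y : choiceType) (M : set (operator X))
    (N : set (operator Y)) (Phi : operator X -> operator Y) : Prop := {
  nsh_codom : forall T, M T -> N (Phi T);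
  nsh_linear : forall (a : R[i]) S T, M S -> M T ->
    Phi (a *: S + T) = a *: Phi S + Phi T;
  nsh_comp : forall S T, M S -> M T -> Phi (S \o T) = Phi S \o Phi T;
  nsh_adj : forall T, M T -> Phi (adj T) = adj (Phi T);
  nsh_normal : forall phi,
    normal_functional N phi -> normal_functional M (phi \o Phi) }.

End l2.

Section GroupVN.
Variables (R : realType) (G : groupType).

Lemma lambda_subproof (s : G) (xi : l2 R G) :
  (fun t => xi (s^-1 * t)%g) \in @sqsummable R G.
Proof.
have := l2P xi; rewrite !inE /= /sqnorm; move: (l2fun xi) => f.
rewrite (@reindex_esum _ _ _ [set: G] [set: G] (fun t => s^-1 * t)%g)//.
split=> [//|x y _ _ /mulgI//|y _]; exists (s * y)%g => //.
by rewrite mulKg.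
Qed.

Definition lambda (s : G) : operator R G := fun xi => L2 (lambda_subproof s xi).

(* The range of lambda is closed under adjoints, so this is lambda(G)''. *)
Definition VN : set (operator R G) := commutant (commutant (range lambda)).

(* The von Neumann algebra tensor product of VN(G) with itself *)
Definition VN2 : set (operator R (G * G)%type) :=
  commutant (commutant
    [set U | exists S T, [/\ VN S, VN T & U = tensop S T]]).

(* These properties determine Gamma on VN(G); its values elsewhere are
   irrelevant. *)
Definition comultiplication
    (Gamma : operator R G -> operator R (G * G)%type) : Prop :=
  normal_star_hom VN VN2 Gamma /\
  forall s, Gamma (lambda s) = tensop (lambda s) (lambda s).

Definition weight_inverse (Gamma : operator R G -> operator R (G * G)%type)
    (omega : operator R G) : Prop :=
  [/\ VN omega,
      op_le (tensop (omega \o adj omega) (omega \o adj omega))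
            (Gamma (omega \o adj omega)),
      op_inj omega &
      op_inj (adj omega)].

Definition coeff (xi eta : l2 R G) : G -> R[i] :=
  fun s => dot (lambda s xi) eta.

(* A(G) as the set of all coefficients of the regular representation, with
   Eymard's norm; A(G) is already closed under sums. *)
Definition fourier : set (G -> R[i]) :=
  [set u | exists xi eta, u = coeff xi eta].

Definition fourier_norm (u : G -> R[i]) : R :=
  inf [set r | exists xi eta, u = coeff xi eta /\ r = l2norm xi * l2norm eta].

(* For T in VN(G) and u in A(G) this does not depend on the choice of xi and
   eta representing u. *)
Definition pairing (T : operator R G) (u : G -> R[i]) : R[i] :=
  xget (0 : R[i])
    [set z | exists xi eta, u = coeff xi eta /\ z = dot (T xi) eta].

(* The element T f of A(G) determined by (S, T f) = (S T, f), S in VN(G) *)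
Definition dual_act (T : operator R G) (f : G -> R[i]) : G -> R[i] :=
  xget (0 : G -> R[i])
    [set g | fourier g /\
       forall S, VN S -> pairing S g = pairing (S \o T) f].

Definition beurling (omega : operator R G) : set (G -> R[i]) :=
  [set dual_act omega f | f in fourier].

Definition beurling_norm (omega : operator R G) (g : G -> R[i]) : R :=
  fourier_norm
    (xget (0 : G -> R[i]) [set f | fourier f /\ dual_act omega f = g]).

End GroupVN.

(* Nonzero characters of a commutative Banach algebra A of functions on X, with
   pointwise operations and norm N. A multiplicative linear functional on such
   an algebra is automatically bounded, so char_bounded is no restriction. *)
Record is_character (R : realType) (X : choiceType) (A : set (X -> R[i]))
    (N : (X -> R[i]) -> R) (chi : A -> R[i]) : Prop := {
  char_linear : forall (a : R[i]) (f g h : A),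
    val h = a *: val f + val g -> chi h = a * chi f + chi g;
  char_mul : forall f g h : A, val h = val f \* val g -> chi h = chi f * chi g;
  char_bounded : exists M : R, forall f : A,
    Num.sqrt (abs2 (chi f)) <= M * N (val f);
  char_neq0 : exists f : A, chi f != 0 }.

Section Spectrum.
Variables (R : realType) (G : groupType) (omega : operator R G).

Definition gelfand_spectrum : set (beurling omega -> R[i]) :=
  [set chi | is_character (beurling_norm omega) chi].

(* sigma corresponds to the character omega u |-> (sigma, u) *)
Definition represents (sigma : operator R G) (chi : beurling omega -> R[i]) :
    Prop :=
  forall (u : G -> R[i]) (f : beurling omega),
    fourier u -> val f = dual_act omega u -> chi f = pairing sigma u.

Definition spec : set (operator R G) :=
  [set sigma | VN sigma /\
    exists2 chi, gelfand_spectrum chi & represents sigma chi].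

Definition eval_char (s : G) : beurling omega -> R[i] := fun f => val f s.

End Spectrum.

Arguments gelfand_spectrum {R G} omega.
Arguments spec {R G} omega.
Arguments eval_char {R G} omega s.

(* Main.v *)
Require Import Defs.
From mathcomp Require Import all_boot all_order all_algebra complex ring lra.
From mathcomp Require Import all_classical all_reals all_analysis.

(** Why the theorem holds. Put a = omega omega* and let V be the isometry of l2(G) into
    l2(G * G) that sends delta t to delta (t, t). Normality of Gamma gives V* Gamma(T) V = T
    for T in VN(G) (Gamma_diag), so compressing the inequality of a weight inverse to the
    diagonal yields
      |(omega* (x) omega* ) V xi| <= |omega* xi|     (weight_diag).
    Operators in VN(G) commute with right translations, so for r in VN(G) one has
    |(r (x) 1) V xi| = |r delta_1| |xi| (ampl_diag_norm): on the range of V only the L2 norm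
    of r for the trace matters. With b = 1 - c a, for c > 0 small, b is a self-adjoint
    contraction and b^n delta_1 tends to 0 since omega* is injective. Taking r = b^n for a
    large n, the operator (1 - r) (x) (1 - r) is nearly the identity on the range of V; on
    the other hand 1 - r = y omega* with y bounded. Together these facts bound omega* from
    below (adj_weight_below), and omega is invertible in VN(G) (weight_invertible).

    Consequently A(G, omega) consists of all coefficient functions of the regular
    representation, among them the point masses. A character is bounded, and finitely
    supported vectors are dense, so it cannot vanish on all point masses; being
    multiplicative, it is then the evaluation at a point (character_eval).

    Normal functionals enter in two places: the identity for Gamma above, and the
    independence of the pairing between VN(G) and A(G) from the chosen vectors. Both
    follow from the fact that a normal functional on VN(G) is determined by its values on
    the operators lambda(s) (normal_vector_functional), which is proved by the double commutant
    argument for an amplification of VN(G) and an orthogonal projection. *)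

Set Implicit Arguments.
Unset Strict Implicit.
Unset Printing Implicit Defensive.

Import Order.TTheory GRing.Theory Num.Theory.

Import numFieldNormedType.Exports.

Local Open Scope classical_set_scope.
Local Open Scope ring_scope.

Local Notation re := complex.Re.
Local Notation im := complex.Im.

(** * Absolutely summable families *)

Section Sums.
Variable R : realType.
Implicit Types X Y : choiceType.

Definition rsummable X (f : X -> R) : Prop :=
  (\esum_(x in [set: X]) `|f x|%:E < +oo)%E.

Lemma le_rsummable X (f g : X -> R) : rsummable g ->
  (forall x, `|f x| <= `|g x|) -> rsummable f.
Proof.
by move=> gX fg; apply: le_lt_trans gX; apply: le_esum => x _; rewrite lee_fin.
Qed.

Lemma rsummableD X (f g : X -> R) :
  rsummable f -> rsummable g -> rsummable (fun x => f x + g x).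
Proof.
move=> fX gX.
apply: (@le_lt_trans _ _ (\esum_(x in [set: X]) (`|f x|%:E + `|g x|%:E)%E)).
  by apply: le_esum => x _; rewrite -EFinD lee_fin ler_normD.
by rewrite esumD ?lte_add_pinfty// => x _; rewrite lee_fin.
Qed.

Lemma rsummableZ X (a : R) (f : X -> R) :
  rsummable f -> rsummable (fun x => a * f x).
Proof.
move=> fX.
apply: (@le_lt_trans _ _ (`|a|%:E * \esum_(x in [set: X]) `|f x|%:E)%E).
  by under eq_esum do rewrite normrM; apply: le_esumZ.
by rewrite lte_mul_pinfty ?lee_fin.
Qed.

Lemma rsummableN X (f : X -> R) : rsummable f -> rsummable (fun x => - f x).
Proof. by move=> fX; apply: le_rsummable fX _ => x; rewrite normrN. Qed.

Lemma ge0_rsummable_fin X (g : X -> R) : (forall x, 0 <= g x) ->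
  rsummable g -> \esum_(x in [set: X]) (g x)%:E \is a fin_num.
Proof.
move=> g0; rewrite /rsummable; under eq_esum do rewrite ger0_norm//.
by move=> gX; rewrite ge0_fin_numE// esum_ge0// => x _; rewrite lee_fin.
Qed.

Definition ppart (x : R) := Num.max x 0.

Lemma ppartE (x : R) : [/\ 0 <= ppart x, 0 <= ppart (- x), x = ppart x - ppart (- x),
  ppart x <= `|x| & ppart (- x) <= `|x|].
Proof.
rewrite /ppart; have [x0|x0] := lerP 0 x.
  by rewrite (@max_r _ _ (- x) 0) ?oppr_le0// subr0; split; rewrite ?ger0_norm.
have x0' : 0 <= - x by rewrite oppr_ge0 ltW.
by rewrite (@max_l _ _ (- x) 0)// opprK add0r ltr0_norm//; split; rewrite ?oppr_ge0.
Qed.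

Lemma ppart_rsummable X (f : X -> R) : rsummable f -> rsummable (fun x => ppart (f x)).
Proof.
move=> fX; apply: le_rsummable fX _ => x.
by case: (ppartE (f x)) => p0 _ _ ple _; rewrite ger0_norm.
Qed.

Lemma neg_rsummable X (f : X -> R) :
  rsummable f -> rsummable (fun x => ppart (- f x)).
Proof. by move=> /rsummableN/ppart_rsummable. Qed.

Lemma ppart_ge0 (x : R) : 0 <= ppart x. Proof. by case: (ppartE x). Qed.

Lemma ppart_fin X (f : X -> R) : rsummable f ->
  \esum_(x in [set: X]) (ppart (f x))%:E \is a fin_num.
Proof. by move=> fX; apply: ge0_rsummable_fin (ppart_rsummable fX) => x; apply: ppart_ge0. Qed.

Lemma neg_fin X (f : X -> R) : rsummable f ->
  \esum_(x in [set: X]) (ppart (- f x))%:E \is a fin_num.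
Proof. by move=> fX; apply: ge0_rsummable_fin (neg_rsummable fX) => x; apply: ppart_ge0. Qed.

(** A signed sum may be computed from any splitting into two summable nonnegative
    families; this turns every identity for signed sums into one for esum. *)
Lemma rsum_diff X (f g h : X -> R) :
  (forall x, 0 <= g x) -> (forall x, 0 <= h x) -> rsummable g -> rsummable h ->
  (forall x, f x = g x - h x) ->
  rsum f = fine (\esum_(x in [set: X]) (g x)%:E)
         - fine (\esum_(x in [set: X]) (h x)%:E).
Proof.
move=> g0 h0 gX hX fE; rewrite /rsum.
have fX : rsummable f.
  by under [f]eq_fun do rewrite fE; apply: rsummableD => //; apply: rsummableN.
have := ge0_rsummable_fin g0 gX; have := ge0_rsummable_fin h0 hX.
have := ppart_fin fX; have := neg_fin fX.
rewrite -/(ppart _) => nf pf hf gf.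
have : (\esum_(x in [set: X]) (ppart (f x))%:E + \esum_(x in [set: X]) (h x)%:E =
   \esum_(x in [set: X]) (g x)%:E + \esum_(x in [set: X]) (ppart (- f x))%:E)%E.
  rewrite -!esumD; do ?by move=> x _; rewrite lee_fin ?ppart_ge0.
  apply: eq_esum => x _; rewrite -!EFinD; congr (_%:E).
  case: (ppartE (f x)) => _ _ + _ _; have := fE x; lra.
move=> /(congr1 fine); rewrite !fineD// /ppart; lra.
Qed.

Lemma ge0_rsumE X (g : X -> R) : (forall x, 0 <= g x) -> rsummable g ->
  rsum g = fine (\esum_(x in [set: X]) (g x)%:E).
Proof.
move=> g0 gX; rewrite (@rsum_diff _ _ g (fun=> 0))//.
- by rewrite [X in _ - fine X]esum1// subr0.
- by rewrite /rsummable esum1// => x _; rewrite normr0.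
- by move=> x; rewrite subr0.
Qed.

Lemma rsumD X (f g : X -> R) : rsummable f -> rsummable g ->
  rsum (fun x => f x + g x) = rsum f + rsum g.
Proof.
move=> fX gX.
have p0 := ppart_ge0.
rewrite (@rsum_diff _ _ (fun x => ppart (f x) + ppart (g x))
  (fun x => ppart (- f x) + ppart (- g x))).
- under eq_esum do rewrite EFinD.
  under [X in _ - fine X]eq_esum do rewrite EFinD.
  rewrite !esumD; do ?by move=> x _; rewrite lee_fin p0.
  rewrite !fineD ?(ppart_fin fX) ?(ppart_fin gX) ?(neg_fin fX) ?(neg_fin gX)//.
  rewrite /rsum /ppart; lra.
- by move=> x; rewrite addr_ge0.
- by move=> x; rewrite addr_ge0.
- by apply: rsummableD; apply: ppart_rsummable.
- by apply: rsummableD; apply: neg_rsummable.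
- move=> x; case: (ppartE (f x)) => _ _ + _ _.
  by case: (ppartE (g x)) => _ _ + _ _; lra.
Qed.

Lemma rsumN X (f : X -> R) : rsum (fun x => - f x) = - rsum f.
Proof.
rewrite /rsum opprB; congr (_ - fine _).
by apply: eq_esum => x _; rewrite opprK.
Qed.

Lemma esumZ X (k : R) (f : X -> R) : 0 <= k -> (forall x, 0 <= f x) ->
  (\esum_(x in [set: X]) (k * f x)%:E = k%:E * \esum_(x in [set: X]) (f x)%:E)%E.
Proof.
rewrite le_eqVlt => /predU1P[<- f0|k0 f0].
  by rewrite mul0e esum1// => x _; rewrite mul0r.
apply/eqP; rewrite eq_le le_esumZ ?(ltW k0)//=.
have := @le_esumZ R X k^-1 (fun x => k * f x).
rewrite invr_ge0 (ltW k0) => /(_ isT) H.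
rewrite -lee_pdivlMl//; apply: le_trans (H _).
  by apply: le_esum => x _; rewrite mulKf ?gt_eqF.
by move=> x; rewrite mulr_ge0// ltW.
Qed.

Lemma rsumZ X (k : R) (f : X -> R) : rsummable f ->
  rsum (fun x => k * f x) = k * rsum f.
Proof.
wlog k0 : k / 0 <= k.
  move=> H fX; case: (leP 0 k) => [/H/(_ fX)//|k0].
  rewrite -[k]opprK mulNr -(H (- k)) ?oppr_ge0 1?ltW//.
  by rewrite -rsumN; congr rsum; apply/funext => x; rewrite mulNr.
move=> fX; rewrite (@rsum_diff _ _ (fun x => k * ppart (f x))
  (fun x => k * ppart (- f x))).
- rewrite !esumZ//; do ?by move=> x; case: (ppartE (f x)).
  rewrite !fineM ?(ppart_fin fX) ?(neg_fin fX)//.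
  by rewrite /= -mulrBr.
- by move=> x; rewrite mulr_ge0//; case: (ppartE (f x)).
- by move=> x; rewrite mulr_ge0//; case: (ppartE (f x)).
- by apply: rsummableZ; apply: ppart_rsummable.
- by apply: rsummableZ; apply: neg_rsummable.
- by move=> x; rewrite -mulrBr; case: (ppartE (f x)) => _ _ <-.
Qed.

Lemma esum_ge_term X (g : X -> \bar R) x : (0 <= g x)%E ->
  (g x <= \esum_(y in [set: X]) g y)%E.
Proof.
move=> g0; apply: esum_ge; exists [set x]; last by rewrite fsbig_set1.
by split.
Qed.

Lemma esum_pair X Y (g : X * Y -> R) : (forall p, 0 <= g p) ->
  \esum_(p in [set: X * Y]) (g p)%:E =
  \esum_(x in [set: X]) \esum_(y in [set: Y]) (g (x, y))%:E.
Proof.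
move=> g0; rewrite esum_esum => [|x y _ _]; last by rewrite lee_fin.
by congr esum; [apply/seteqP; split|apply/funext => -[]].
Qed.

Lemma fin_slice X Y (g : X * Y -> R) : (forall p, 0 <= g p) -> rsummable g ->
  forall x, \esum_(y in [set: Y]) (g (x, y))%:E \is a fin_num.
Proof.
move=> g0 gX x; rewrite ge0_fin_numE; last first.
  by apply: esum_ge0 => y _; rewrite lee_fin.
have := ge0_rsummable_fin g0 gX.
rewrite esum_pair// ge0_fin_numE; last first.
  by apply: esum_ge0 => ? _; apply: esum_ge0 => y _; rewrite lee_fin.
apply: le_lt_trans; apply: (esum_ge_term (g := fun x => \esum_(y in setT) (g (x, y))%:E)).
by apply: esum_ge0 => y _; rewrite lee_fin.
Qed.

(** Fubini for absolutely summable families: Tonelli is applied to the positive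
    and negative parts, whose inner sums are finite and give a splitting of the
    outer sum. *)
Lemma rsum_pair X Y (f : X * Y -> R) : rsummable f ->
  rsum f = rsum (fun x => rsum (fun y => f (x, y))).
Proof.
move=> fX.
pose P x := \esum_(y in [set: Y]) (ppart (f (x, y)))%:E.
pose N x := \esum_(y in [set: Y]) (ppart (- f (x, y)))%:E.
have p0 := ppart_ge0.
have pe (z : R) : (0 <= (ppart z)%:E)%E by rewrite lee_fin.
have fP x : P x \is a fin_num.
  exact: (fin_slice (g := fun p => ppart (f p)) (fun=> p0 _) (ppart_rsummable fX)).
have fN x : N x \is a fin_num.
  exact: (fin_slice (g := fun p => ppart (- f p)) (fun=> p0 _) (neg_rsummable fX)).
have P0 x : (0 <= P x)%E by apply: esum_ge0.
have N0 x : (0 <= N x)%E by apply: esum_ge0.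
have EP : \esum_(p in [set: X * Y]) (ppart (f p))%:E =
    \esum_(x in [set: X]) (fine (P x))%:E.
  rewrite (esum_pair (g := fun p => ppart (f p)))//.
  by apply: eq_esum => x _; rewrite fineK.
have EN : \esum_(p in [set: X * Y]) (ppart (- f p))%:E =
    \esum_(x in [set: X]) (fine (N x))%:E.
  rewrite (esum_pair (g := fun p => ppart (- f p)))//.
  by apply: eq_esum => x _; rewrite fineK.
have fine0 (z : \bar R) : (0 <= z)%E -> 0 <= fine z by exact: fine_ge0.
rewrite [RHS](@rsum_diff _ _ (fine \o P) (fine \o N)).
- by rewrite -EP -EN.
- by move=> x; apply: fine0.
- by move=> x; apply: fine0.
- rewrite /rsummable; under eq_esum do rewrite ger0_norm ?fine0//.
  rewrite -EP -ge0_fin_numE ?esum_ge0//.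
  exact: ppart_fin.
- rewrite /rsummable; under eq_esum do rewrite ger0_norm ?fine0//.
  rewrite -EN -ge0_fin_numE ?esum_ge0//.
  exact: neg_fin.
- by [].
Qed.

Lemma esum_bij X Y (e : X -> Y) (g : Y -> \bar R) : bijective e ->
  (\esum_(y in [set: Y]) g y = \esum_(x in [set: X]) g (e x))%E.
Proof.
move=> eb; apply: (@reindex_esum _ _ _ [set: X] [set: Y] e).
case: eb => e' eK e'K; split=> // [x y _ _|y _]; first exact: (can_inj eK).
by exists (e' y).
Qed.

Lemma rsum_bij X Y (e : X -> Y) (f : Y -> R) : bijective e ->
  rsum f = rsum (fun x => f (e x)).
Proof. by move=> eb; rewrite /rsum !(esum_bij _ eb). Qed.

Lemma esum_single X (g : X -> \bar R) x0 : (0 <= g x0)%E ->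
  (forall x, x != x0 -> g x = 0%E) -> (\esum_(x in [set: X]) g x = g x0)%E.
Proof.
move=> g0 gx; rewrite -[RHS](@esum_set1 _ _ x0)// [RHS]esum_mkcond.
apply: eq_esum => x _; case: ifPn => //; rewrite notin_setE => /eqP/gx//.
Qed.

Lemma rsum_single X (f : X -> R) x0 : (forall x, x != x0 -> f x = 0) ->
  rsum f = f x0.
Proof.
move=> fx; rewrite /rsum.
have p0 (x : R) : (0 <= (Num.max x 0)%:E)%E by rewrite lee_fin; apply: ppart_ge0.
rewrite (@esum_single _ _ x0)//; last by move=> x /fx ->; rewrite maxxx.
rewrite (@esum_single _ _ x0)//; last by move=> x /fx ->; rewrite oppr0 maxxx.
by rewrite /=; case: (ppartE (f x0)).
Qed.

Lemma esum_option X (g : option X -> \bar R) : (forall x, 0 <= g x)%E ->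
  (\esum_(x in [set: option X]) g x =
     g None + \esum_(x in [set: X]) g (Some x))%E.
Proof.
move=> g0; rewrite (@esumID _ _ [set None])//; congr (_ + _)%E.
  by rewrite setTI esum_set1.
rewrite setTI; apply: (@reindex_esum _ _ _ [set: X] _ Some).
split=> [x _ //|x y _ _ []//|[x|] //= _]; by exists x.
Qed.

Lemma rsum_option X (f : option X -> R) : rsummable (fun x => f (Some x)) ->
  rsum f = f None + rsum (fun x => f (Some x)).
Proof.
move=> fX; rewrite /rsum.
have p0 (x : R) : (0 <= (Num.max x 0)%:E)%E by rewrite lee_fin; apply: ppart_ge0.
rewrite !esum_option// !fineD//.
- by case: (ppartE (f None)) => _ _; rewrite /ppart /=; lra.
- exact: neg_fin fX.
- exact: ppart_fin fX.
Qed.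

Definition csummable X (f : X -> R[i]) : Prop :=
  rsummable (fun x => re (f x)) /\ rsummable (fun x => im (f x)).

Lemma csummable_le X (f : X -> R[i]) (g : X -> R) : rsummable g ->
  (forall x, `|re (f x)| <= g x /\ `|im (f x)| <= g x) -> csummable f.
Proof.
move=> gX H; split; apply: le_rsummable gX _ => x; case: (H x) => H1 H2;
  by rewrite (le_trans _ (ler_norm _)).
Qed.

Lemma reM (a b : R[i]) : re (a * b) = re a * re b + - im a * im b.
Proof. by case: a; case: b => * /=; rewrite mulNr. Qed.

Lemma imM (a b : R[i]) : im (a * b) = re a * im b + im a * re b.
Proof. by case: a; case: b => * /=. Qed.

Lemma csummableZ X (a : R[i]) (f : X -> R[i]) :
  csummable f -> csummable (fun x => a * f x).
Proof.
move=> [f1 f2]; split.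
  by under eq_fun do rewrite reM; apply: rsummableD; apply: rsummableZ.
by under eq_fun do rewrite imM; apply: rsummableD; apply: rsummableZ.
Qed.

Lemma csumD X (f g : X -> R[i]) : csummable f -> csummable g ->
  csum (fun x => f x + g x) = csum f + csum g.
Proof.
move=> [f1 f2] [g1 g2]; rewrite /csum.
under eq_fun do rewrite raddfD; under [X in Complex _ (rsum X)]eq_fun do rewrite raddfD.
by rewrite /= !rsumD.
Qed.

Lemma csumZ X (a : R[i]) (f : X -> R[i]) : csummable f ->
  csum (fun x => a * f x) = a * csum f.
Proof.
move=> [f1 f2]; rewrite /csum.
under eq_fun do rewrite reM; under [X in Complex _ (rsum X)]eq_fun do rewrite imM.
rewrite /= !rsumD; try exact: rsummableZ.
by rewrite !rsumZ//; case: a => a b /=; rewrite mulNr.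
Qed.

Lemma csum_conj X (f : X -> R[i]) :
  csum (fun x => conjc (f x)) = conjc (csum f).
Proof.
rewrite /csum /= -rsumN; congr Complex; congr rsum;
 by apply/funext => x; case: (f x).
Qed.

Lemma csum_pair X Y (f : X * Y -> R[i]) : csummable f ->
  csum f = csum (fun x => csum (fun y => f (x, y))).
Proof. by move=> [f1 f2]; rewrite /csum !rsum_pair. Qed.

Lemma csum_bij X Y (e : X -> Y) (f : Y -> R[i]) : bijective e ->
  csum f = csum (fun x => f (e x)).
Proof.
by move=> eb; rewrite /csum [rsum _](rsum_bij _ eb) [X in Complex _ X](rsum_bij _ eb).
Qed.

Lemma csum_single X (f : X -> R[i]) x0 : (forall x, x != x0 -> f x = 0) ->
  csum f = f x0.
Proof.
move=> fx; rewrite /csum !(@rsum_single _ _ x0); try by move=> x /fx ->.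
by case: (f x0).
Qed.

Lemma csum_option X (f : option X -> R[i]) : csummable (fun x => f (Some x)) ->
  csum f = f None + csum (fun x => f (Some x)).
Proof.
by move=> [f1 f2]; rewrite /csum !rsum_option//; case: (f None).
Qed.

End Sums.

(** * Square-summable families as a Hilbert space *)

Arguments dot : simpl never.
Arguments csum : simpl never.

Section ReIm.
Variable R : realType.
Implicit Types a b : R[i].

Lemma reD a b : re (a + b) = re a + re b. Proof. by case: a b => ? ? []. Qed.
Lemma imD a b : im (a + b) = im a + im b. Proof. by case: a b => ? ? []. Qed.
Lemma reN a : re (- a) = - re a. Proof. by case: a. Qed.
Lemma imN a : im (- a) = - im a. Proof. by case: a. Qed.
Lemma reB a b : re (a - b) = re a - re b. Proof. by rewrite reD reN. Qed.
Lemma imB a b : im (a - b) = im a - im b. Proof. by rewrite imD imN. Qed.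

End ReIm.

Section HilbertSpaceDef.
Variables (R : realType) (X : choiceType).
Implicit Types xi eta zeta : l2 R X.

Lemma l2_ext xi eta : (forall x, xi x = eta x) -> xi = eta.
Proof. by move=> H; apply/val_inj/funext. Qed.

Lemma l2DE xi eta x : (xi + eta) x = xi x + eta x. Proof. by []. Qed.
Lemma l2ZE (a : R[i]) xi x : (a *: xi) x = a * xi x. Proof. by []. Qed.
Lemma l2BE xi eta x : (xi - eta) x = xi x - eta x. Proof. by []. Qed.

Definition nsq xi : R := fine (sqnorm xi).

Lemma sqnorm_ge0 (f : X -> R[i]) : (0 <= sqnorm f)%E.
Proof. by apply: esum_ge0 => x _; rewrite lee_fin abs2_ge0. Qed.

Lemma sqnormE xi : sqnorm xi = (nsq xi)%:E.
Proof.
by rewrite fineK// ge0_fin_numE ?sqnorm_ge0//; have := l2P xi; rewrite inE.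
Qed.

Lemma nsq_ge0 xi : 0 <= nsq xi.
Proof. by rewrite fine_ge0 ?sqnorm_ge0. Qed.

Lemma abs2_rsummable xi : rsummable (fun x => abs2 (xi x)).
Proof.
rewrite /rsummable; under eq_esum do rewrite ger0_norm ?abs2_ge0//.
by rewrite -/(sqnorm xi) sqnormE ltry.
Qed.

Lemma nsqE xi : nsq xi = rsum (fun x => abs2 (xi x)).
Proof.
by rewrite ge0_rsumE//; [move=> x; apply: abs2_ge0|apply: abs2_rsummable].
Qed.

Lemma le_abs2_nsq xi x : abs2 (xi x) <= nsq xi.
Proof.
rewrite -lee_fin -sqnormE.
by apply: (esum_ge_term (g := fun x => (abs2 (xi x))%:E)); rewrite lee_fin abs2_ge0.
Qed.

Lemma abs2_eq0 (z : R[i]) : abs2 z = 0 -> z = 0.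
Proof.
case: z => a b; rewrite /abs2 /= => /eqP.
by rewrite paddr_eq0 ?sqr_ge0// !sqrf_eq0 => /andP[/eqP -> /eqP ->].
Qed.

Lemma nsq_eq0 xi : nsq xi = 0 -> xi = 0.
Proof.
move=> xi0; apply: l2_ext => x; apply: abs2_eq0; apply/eqP.
by rewrite eq_le abs2_ge0 andbT -xi0 le_abs2_nsq.
Qed.

Lemma dot_csummable xi eta : csummable (fun x => xi x * conjc (eta x)).
Proof.
apply: (@csummable_le _ _ _ (fun x => abs2 (xi x) + abs2 (eta x))).
  by apply: rsummableD; apply: abs2_rsummable.
move=> x; case: (xi x) (eta x) => a b [c d]; rewrite /abs2 /= !ler_norml.
have := sqr_ge0 (a - c); have := sqr_ge0 (a + c).
have := sqr_ge0 (b - d); have := sqr_ge0 (b + d).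
have := sqr_ge0 (a - d); have := sqr_ge0 (a + d).
have := sqr_ge0 (b - c); have := sqr_ge0 (b + c).
have := sqr_ge0 a; have := sqr_ge0 b; have := sqr_ge0 c; have := sqr_ge0 d.
split; apply/andP; split; lra.
Qed.

Lemma dotDl xi xi' eta : dot (xi + xi') eta = dot xi eta + dot xi' eta.
Proof.
rewrite /dot -csumD; try exact: dot_csummable.
by congr csum; apply/funext => x; rewrite l2DE mulrDl.
Qed.

Lemma dotZl (a : R[i]) xi eta : dot (a *: xi) eta = a * dot xi eta.
Proof.
rewrite /dot -csumZ; try exact: dot_csummable.
by congr csum; apply/funext => x; rewrite l2ZE mulrA.
Qed.

Lemma dotC xi eta : dot eta xi = conjc (dot xi eta).
Proof.
rewrite /dot -csum_conj; congr csum; apply/funext => x.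
by rewrite rmorphM/= conjcK mulrC.
Qed.

Lemma dotDr xi eta eta' : dot xi (eta + eta') = dot xi eta + dot xi eta'.
Proof. by rewrite !(dotC _ xi) dotDl rmorphD. Qed.

Lemma dotZr (a : R[i]) xi eta : dot xi (a *: eta) = conjc a * dot xi eta.
Proof. by rewrite !(dotC _ xi) dotZl rmorphM. Qed.

Lemma dotNl xi eta : dot (- xi) eta = - dot xi eta.
Proof. by rewrite -scaleN1r dotZl mulN1r. Qed.

Lemma dotNr xi eta : dot xi (- eta) = - dot xi eta.
Proof.
rewrite -scaleN1r dotZr (_ : conjc (-1) = -1) ?mulN1r//.
by rewrite -[-1]/(Complex (-1) (-0)) /= !oppr0.
Qed.

Lemma dotBl xi xi' eta : dot (xi - xi') eta = dot xi eta - dot xi' eta.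
Proof. by rewrite dotDl dotNl. Qed.

Lemma dotBr xi eta eta' : dot xi (eta - eta') = dot xi eta - dot xi eta'.
Proof. by rewrite dotDr dotNr. Qed.

Lemma dot0l eta : dot 0 eta = 0.
Proof. by rewrite -(scale0r (0 : l2 R X)) dotZl mul0r. Qed.

Lemma dot0r xi : dot xi 0 = 0.
Proof. by rewrite dotC dot0l conjc0. Qed.

Lemma dot_nsq xi : dot xi xi = Complex (nsq xi) 0.
Proof.
rewrite nsqE /dot /csum; congr Complex.
  by congr rsum; apply/funext => x; case: (xi x) => a b; rewrite /abs2 /=; ring.
rewrite -[RHS](mul0r (rsum (fun x => abs2 (xi x)))) -rsumZ; last first.
  exact: abs2_rsummable.
by congr rsum; apply/funext => x; case: (xi x) => a b /=; ring.
Qed.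

Lemma dotE xi eta : dot xi eta = csum (fun x => xi x * conjc (eta x)).
Proof. by []. Qed.

Lemma l2normE xi : l2norm xi = Num.sqrt (nsq xi).
Proof. by []. Qed.

Lemma delta_subproof (x : X) :
  (fun y => (y == x)%:R : R[i]) \in @sqsummable R X.
Proof.
rewrite inE /sqnorm (@esum_single _ _ _ x); first by rewrite eqxx ltry.
- by rewrite lee_fin abs2_ge0.
- by move=> y /negbTE ->; rewrite /abs2/= expr0n addr0.
Qed.

Definition delta (x : X) : l2 R X := L2 (delta_subproof x).

Lemma deltaE x y : delta x y = (y == x)%:R. Proof. by []. Qed.

Lemma dot_delta xi x : dot xi (delta x) = xi x.
Proof.
rewrite /dot (@csum_single _ _ _ x).
  by rewrite deltaE eqxx conjc1 mulr1.
by move=> y /negbTE yx; rewrite deltaE yx conjc0 mulr0.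
Qed.

End HilbertSpaceDef.

(** Otherwise unification compares inner products by unfolding the underlying
    extended-real sums, which does not terminate in practice. *)
Global Opaque dot l2norm nsq.
Arguments delta {R X} x.

Section HilbertSpace.
Variables (R : realType) (X : choiceType).
Implicit Types xi eta zeta : l2 R X.

Lemma nsq_dot xi : nsq xi = re (dot xi xi).
Proof. by rewrite dot_nsq. Qed.

Lemma re_dotC xi eta : re (dot eta xi) = re (dot xi eta).
Proof. by rewrite dotC; case: (dot xi eta). Qed.

Lemma nsqD xi eta : nsq (xi + eta) = nsq xi + 2 * re (dot xi eta) + nsq eta.
Proof.
by rewrite nsq_dot dotDl !dotDr !reD -(nsq_dot xi) -(nsq_dot eta) (re_dotC xi eta); ring.
Qed.

Lemma nsqZ (a : R[i]) xi : nsq (a *: xi) = abs2 a * nsq xi.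
Proof.
rewrite nsq_dot dotZl dotZr dot_nsq; case: a => a b; rewrite /abs2 /=; ring.
Qed.

Lemma abs2N (z : R[i]) : abs2 (- z) = abs2 z.
Proof. by case: z => a b; rewrite /abs2 /= !sqrrN. Qed.

Lemma abs2J (z : R[i]) : abs2 (conjc z) = abs2 z.
Proof. by case: z => a b; rewrite /abs2/= sqrrN. Qed.

Lemma nsqN xi : nsq (- xi) = nsq xi.
Proof. by rewrite -scaleN1r nsqZ abs2N /abs2/= expr1n expr0n/= addr0 mul1r. Qed.

Lemma nsqB xi eta : nsq (xi - eta) = nsq xi - 2 * re (dot xi eta) + nsq eta.
Proof. by rewrite nsqD dotNr nsqN reN; ring. Qed.

(** The discriminant of the nonnegative quadratic polynomial
    t |-> nsq (xi - t eta). *)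
Lemma CS_re xi eta : re (dot xi eta) ^+ 2 <= nsq xi * nsq eta.
Proof.
set d := re _.
have H (t : R) : 0 <= nsq xi - 2 * t * d + t ^+ 2 * nsq eta.
  have := nsq_ge0 (xi - (Complex t 0) *: eta); rewrite nsqB dotZr nsqZ.
  have -> : re (conjc (Complex t 0) * dot xi eta) = t * d.
    by rewrite /d; case: (dot xi eta) => u v /=; rewrite oppr0 mul0r subr0.
  have -> : abs2 (Complex t 0 : R[i]) = t ^+ 2 by rewrite /abs2 /= expr0n addr0.
  lra.
have [e0|e0] := eqVneq (nsq eta) 0.
  have -> : d = 0 by rewrite /d (nsq_eq0 e0) dot0r.
  by rewrite expr0n mulr_ge0 ?nsq_ge0.
have e1 : 0 < nsq eta by rewrite lt_def e0 nsq_ge0.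
have := H (d / nsq eta).
have -> : nsq xi - 2 * (d / nsq eta) * d + (d / nsq eta) ^+ 2 * nsq eta =
  (nsq xi * nsq eta - d ^+ 2) / nsq eta by field.
by rewrite pmulr_lge0 ?invr_gt0// subr_ge0.
Qed.

Lemma l2norm_ge0 xi : 0 <= l2norm xi.
Proof. by rewrite l2normE sqrtr_ge0. Qed.

Lemma l2norm_sqr xi : l2norm xi ^+ 2 = nsq xi.
Proof. by rewrite l2normE sqr_sqrtr ?nsq_ge0. Qed.

Lemma CS_norm xi eta : re (dot xi eta) <= l2norm xi * l2norm eta.
Proof.
apply: le_trans (ler_norm _) _.
rewrite -ler_sqr ?nnegrE ?mulr_ge0 ?l2norm_ge0//.
by rewrite real_normK ?num_real// exprMn !l2norm_sqr CS_re.
Qed.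

(** Rotating xi by the conjugate of the inner product makes the latter real,
    which reduces the bound to its real-part version. *)
Lemma CS xi eta : Num.sqrt (abs2 (dot xi eta)) <= l2norm xi * l2norm eta.
Proof.
set z := dot xi eta; set m := Num.sqrt _.
have m0 : 0 <= m by exact: sqrtr_ge0.
have m2 : m ^+ 2 = abs2 z by rewrite sqr_sqrtr ?abs2_ge0.
have := CS_norm (conjc z *: xi) eta; rewrite dotZl -/z.
have -> : re (conjc z * z) = m ^+ 2.
  by rewrite m2; case: (z) => a b; rewrite /abs2/=; ring.
have -> : l2norm (conjc z *: xi) = m * l2norm xi.
  rewrite l2normE nsqZ sqrtrM ?abs2_ge0// abs2J//.
have [-> _|m1] := eqVneq m 0; first by rewrite mulr_ge0 ?l2norm_ge0.
by rewrite expr2 -mulrA ler_pM2l// lt_def m1.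
Qed.

Lemma l2normD xi eta : l2norm (xi + eta) <= l2norm xi + l2norm eta.
Proof.
rewrite -ler_sqr ?nnegrE ?addr_ge0 ?l2norm_ge0//.
by rewrite l2norm_sqr nsqD sqrrD !l2norm_sqr; have := CS_norm xi eta; lra.
Qed.

Lemma l2normZ (a : R[i]) xi : l2norm (a *: xi) = Num.sqrt (abs2 a) * l2norm xi.
Proof. by rewrite l2normE nsqZ sqrtrM ?abs2_ge0. Qed.

Lemma l2normN xi : l2norm (- xi) = l2norm xi.
Proof. by rewrite !l2normE nsqN. Qed.

Lemma l2normC xi eta : l2norm (xi - eta) = l2norm (eta - xi).
Proof. by rewrite -l2normN opprB. Qed.

Lemma l2norm_tri zeta xi eta :
  l2norm (xi - eta) <= l2norm (xi - zeta) + l2norm (zeta - eta).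
Proof. by apply: le_trans (l2normD _ _); rewrite addrA subrK. Qed.

Lemma l2norm_le xi (r : R) : 0 <= r -> (l2norm xi <= r) = (nsq xi <= r ^+ 2).
Proof. by move=> r0; rewrite -l2norm_sqr ler_sqr ?nnegrE ?l2norm_ge0. Qed.

Lemma l2norm0 : l2norm (0 : l2 R X) = 0.
Proof. by rewrite l2normE nsq_dot dot0l sqrtr0. Qed.

Lemma l2norm_eq0 xi : l2norm xi = 0 -> xi = 0.
Proof. by move=> H; apply: nsq_eq0; rewrite -l2norm_sqr H expr0n. Qed.

Lemma l2norm_small xi : (forall e, 0 < e -> l2norm xi <= e) -> xi = 0.
Proof.
move=> H; apply: l2norm_eq0; apply/eqP; rewrite eq_le l2norm_ge0 andbT.
by apply/ler_addgt0Pl => e e0; rewrite addr0 H.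
Qed.

Lemma nsq_delta x : nsq (delta x : l2 R X) = 1.
Proof.
by rewrite nsq_dot dot_delta deltaE eqxx.
Qed.

Lemma l2norm_delta x : l2norm (delta x : l2 R X) = 1.
Proof. by rewrite l2normE nsq_delta sqrtr1. Qed.

Lemma sum_l2E (I : Type) (s : seq I) (F : I -> l2 R X) y :
  (\sum_(i <- s) F i) y = \sum_(i <- s) F i y.
Proof. by elim: s => [|i s IH]; rewrite ?big_nil// !big_cons l2DE IH. Qed.

Lemma truncE (c : X -> R[i]) (s : seq X) y : uniq s ->
  (\sum_(x <- s) c x *: (delta x : l2 R X)) y = if y \in s then c y else 0.
Proof.
move=> us; rewrite sum_l2E.
rewrite (eq_bigr (fun x => c x * (y == x)%:R)) => [|x _ //]; case: ifP => ys.
  rewrite (bigD1_seq y)//= eqxx mulr1 big1 ?addr0// => x xy.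
  by rewrite eq_sym (negbTE xy) mulr0.
rewrite big_seq big1// => x xs.
by case: eqP => [yx|]; rewrite ?mulr0//; move: ys; rewrite yx xs.
Qed.

Lemma finsum_le_nsq xi (A : set X) : finite_set A ->
  \sum_(x <- finmap.enum_fset (fset_set A)) abs2 (xi x) <= nsq xi.
Proof.
move=> finA; rewrite -lee_fin -sqnormE; apply: esum_ge; exists A; first by split.
by rewrite fsbig_finite//= sumEFin.
Qed.

Lemma fin_dense xi (e : R) : 0 < e -> exists s : seq X,
  l2norm (xi - \sum_(x <- s) xi x *: delta x) <= e.
Proof.
move=> e0.
have : ((nsq xi - e ^+ 2)%:E < sqnorm xi)%E.
  by rewrite sqnormE lte_fin ltrBlDr ltrDl exprn_gt0.
rewrite /sqnorm => /ereal_sup_gt[_ [A [finA _] <-] HA].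
exists (finmap.enum_fset (fset_set A)); rewrite l2norm_le ?(ltW e0)//.
set tr := \sum_(x <- _) _; rewrite -lee_fin -sqnormE.
have <- : \esum_(x in ~` A) (abs2 (xi x))%:E = sqnorm (xi - tr).
  rewrite esum_mkcond; apply: eq_esum => x _; rewrite l2BE truncE ?fset_uniq//.
  rewrite in_fset_set// in_setC; case: (boolP (x \in A)) => _ /=; rewrite ?subr0//.
  by rewrite subrr /abs2 /= expr0n addr0.
have := sqnormE xi; rewrite /sqnorm (@esumID _ _ A) => [|x _]; last first.
  by rewrite lee_fin abs2_ge0.
rewrite !setTI (esum_fset (F := A))// => [H|x _]; last by rewrite lee_fin abs2_ge0.
have S0 : (0 <= \esum_(x in ~` A) (abs2 (xi x))%:E)%E.
  by apply: esum_ge0 => x _; rewrite lee_fin abs2_ge0.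
move: HA H S0; move: (\sum_(x \in A) _)%E (\esum_(_ in _) _)%E.
move=> [u| |] [v| |]//=; rewrite ?lte_fin -?EFinD ?lee_fin// => H1 [H2] v0; lra.
Qed.

(** Induction along finitely supported vectors, which are dense; the last hypothesis says
    that P is closed. *)
Lemma dense_ind (P : l2 R X -> Prop) : P 0 ->
  (forall a x eta, P eta -> P (a *: delta x + eta)) ->
  (forall xi, (forall e, 0 < e -> exists2 eta, P eta & l2norm (xi - eta) <= e) ->
     P xi) ->
  forall xi, P xi.
Proof.
move=> P0 PD Pc xi; apply: Pc => e /(fin_dense xi)[s Hs].
exists (\sum_(x <- s) xi x *: delta x) => //.
by elim: s {Hs} => [|x s IH]; rewrite ?big_nil ?big_cons//; apply: PD.
Qed.

Definition l2cauchy (u : nat -> l2 R X) := forall e : R, 0 < e ->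
  exists N, forall m n, (N <= m)%N -> (N <= n)%N -> l2norm (u m - u n) <= e.

Definition l2cvg (u : nat -> l2 R X) xi := forall e : R, 0 < e ->
  exists N, forall n, (N <= n)%N -> l2norm (xi - u n) <= e.

Lemma abs_re_le (z : R[i]) : `|re z| <= Num.sqrt (abs2 z).
Proof. by rewrite -sqrtr_sqr ler_sqrt ?abs2_ge0// lerDl sqr_ge0. Qed.

Lemma abs_im_le (z : R[i]) : `|im z| <= Num.sqrt (abs2 z).
Proof. by rewrite -sqrtr_sqr ler_sqrt ?abs2_ge0// lerDr sqr_ge0. Qed.

Lemma l2_point xi x : Num.sqrt (abs2 (xi x)) <= l2norm xi.
Proof. by rewrite l2normE ler_sqrt ?nsq_ge0// le_abs2_nsq. Qed.

Lemma real_cauchy_cvg (u : nat -> R) : (forall e : R, 0 < e ->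
  exists N, forall m n, (N <= m)%N -> (N <= n)%N -> `|u m - u n| <= e) ->
  exists l : R, u @ \oo --> l.
Proof.
move=> H; suff /cvg_ex[l ul] : cvgn u by exists l.
apply/cauchy_cvgP/cauchy_exP => e e0.
have [N HN] := H (e / 2) (divr_gt0 e0 (ltr0n _ 2)).
exists (u N); exists N => // n /= Nn; rewrite /ball /= .
by apply: le_lt_trans (HN _ _ (leqnn N) Nn) _; lra.
Qed.

(** The pointwise limit of a Cauchy sequence is its limit in norm: bounds on finite
    partial sums pass to the limit, and esum is their supremum. *)
Lemma l2_complete u : l2cauchy u -> exists xi, l2cvg u xi.
Proof.
move=> uC.
have uP x : exists z : R[i], (fun n => re (u n x)) @ \oo --> re z /\
    (fun n => im (u n x)) @ \oo --> im z.
  have [a ua] : exists a : R, (fun n => re (u n x)) @ \oo --> a.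
    apply: real_cauchy_cvg => e /uC[N HN]; exists N => m n Nm Nn.
    apply: le_trans (HN _ _ Nm Nn); apply: le_trans (l2_point _ x).
    by rewrite l2BE -reB abs_re_le.
  have [b ub] : exists b : R, (fun n => im (u n x)) @ \oo --> b.
    apply: real_cauchy_cvg => e /uC[N HN]; exists N => m n Nm Nn.
    apply: le_trans (HN _ _ Nm Nn); apply: le_trans (l2_point _ x).
    by rewrite l2BE -imB abs_im_le.
  by exists (Complex a b).
have [f fP] := choice uP.
have H (e : R) : 0 < e -> exists N, forall n, (N <= n)%N ->
    (\esum_(x in [set: X]) (abs2 (f x - u n x))%:E <= (e ^+ 2)%:E)%E.
  move=> e0; have [N HN] := uC e e0; exists N => n Nn.
  apply: ge_ereal_sup => _ [A [finA _] <-].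
  rewrite fsbig_finite//= sumEFin lee_fin.
  have L : (fun m => \sum_(x <- finmap.enum_fset (fset_set A)) abs2 (u m x - u n x)) @ \oo -->
      \sum_(x <- finmap.enum_fset (fset_set A)) abs2 (f x - u n x).
    elim: (finmap.enum_fset (fset_set A)) => [|x s IH].
      by under eq_fun do rewrite big_nil; rewrite big_nil; apply: cvg_cst.
    under eq_fun do rewrite big_cons; rewrite big_cons; apply: cvgD => //.
    rewrite /abs2; case: (fP x) => fr fi.
    under eq_fun do rewrite reB imB; rewrite reB imB.
    by apply: cvgD; rewrite expr2; under eq_fun do rewrite expr2;
      apply: cvgM; apply: cvgB => //; apply: cvg_cst.
  apply: (cvgr_to_le L); exists N => // m /= Nm.
  apply: le_trans (finsum_le_nsq (u m - u n) finA) _.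
  by rewrite -l2norm_le ?(ltW e0)// HN.
have [N HN] := H 1 ltr01.
have fl2 : f \in @sqsummable R X.
  (* By H, f differs from u N by a square-summable family. *)
  rewrite -[f](subrK (u N : X -> R[i])) rpredD ?l2P//.
  by rewrite inE /= (le_lt_trans (HN N (leqnn N)))// ltry.
exists (L2 fl2) => e e0; have [M HM] := H e e0; exists M => n Mn.
by rewrite l2norm_le ?(ltW e0)// -lee_fin -sqnormE; apply: HM.
Qed.

End HilbertSpace.

(** * Bounded operators and orthogonal projections *)

Section BoundedOperators.
Variables (R : realType) (X : choiceType).
Implicit Types (xi eta zeta : l2 R X) (T S : operator R X).

Lemma bopD T : bounded_operator T -> forall xi eta, T (xi + eta) = T xi + T eta.
Proof. by move=> [TL _] xi eta; have := TL 1 xi eta; rewrite !scale1r. Qed.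

Lemma bop0 T : bounded_operator T -> T 0 = 0.
Proof. by move=> /bopD H; apply: (@addrI _ (T 0)); rewrite -H !addr0. Qed.

Lemma bopZ T : bounded_operator T -> forall a xi, T (a *: xi) = a *: T xi.
Proof.
by move=> bT a xi; have := bT.1 a xi 0; rewrite (bop0 bT) !addr0.
Qed.

Lemma bopN T : bounded_operator T -> forall xi, T (- xi) = - T xi.
Proof. by move=> bT xi; rewrite -scaleN1r (bopZ bT) scaleN1r. Qed.

Lemma bopB T : bounded_operator T -> forall xi eta, T (xi - eta) = T xi - T eta.
Proof. by move=> bT xi eta; rewrite (bopD bT) (bopN bT). Qed.

Lemma bop_bound T : bounded_operator T ->
  exists M : R, 0 < M /\ forall xi, l2norm (T xi) <= M * l2norm xi.
Proof.
case=> _ [M HM]; exists (`|M| + 1); split; first by rewrite ltr_wpDl.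
move=> xi; apply: le_trans (HM xi) _; rewrite ler_wpM2r ?l2norm_ge0//.
by rewrite ler_wpDr// ler_norm.
Qed.

Lemma bop_id : bounded_operator (@id (l2 R X)).
Proof. by split=> //; exists 1 => xi; rewrite mul1r. Qed.

Lemma bop_comp T S :
  bounded_operator T -> bounded_operator S -> bounded_operator (T \o S).
Proof.
move=> bT bS; split=> [a xi eta|]; first by rewrite /= bopD// bopZ// bopD// bopZ.
have [M [M0 HM]] := bop_bound bT; have [K [K0 HK]] := bop_bound bS.
exists (M * K) => xi /=; apply: le_trans (HM _) _.
by rewrite -mulrA ler_wpM2l ?(ltW M0).
Qed.

Lemma bop_add T S : bounded_operator T -> bounded_operator S ->
  bounded_operator (fun xi => T xi + S xi).
Proof.
move=> bT bS; split=> [a xi eta|].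
  by rewrite (bopD bT) (bopD bS) (bopZ bT) (bopZ bS) scalerDr addrACA.
have [M [M0 HM]] := bop_bound bT; have [K [K0 HK]] := bop_bound bS.
exists (M + K) => xi; apply: le_trans (l2normD _ _) _.
by rewrite mulrDl lerD.
Qed.

Lemma bop_scale (a : R[i]) T :
  bounded_operator T -> bounded_operator (fun xi => a *: T xi).
Proof.
move=> bT; split=> [b xi eta|].
  by rewrite (bopD bT) (bopZ bT) scalerDr !scalerA mulrC.
have [M [M0 HM]] := bop_bound bT.
exists (Num.sqrt (abs2 a) * M) => xi.
by rewrite l2normZ -mulrA ler_wpM2l ?sqrtr_ge0.
Qed.

Lemma bop_sub T S : bounded_operator T -> bounded_operator S ->
  bounded_operator (fun xi => T xi - S xi).
Proof.
move=> bT bS; rewrite (_ : (fun _ => _) = fun xi => T xi + (-1) *: S xi).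
  by apply: bop_add => //; apply: bop_scale.
by apply/funext => xi; rewrite scaleN1r.
Qed.

Lemma bop_iter T n : bounded_operator T -> bounded_operator (iter n T).
Proof.
move=> bT; elim: n => [|n IH]; first exact: bop_id.
exact: (bop_comp bT IH).
Qed.

(** Two bounded operators agree on a closed subspace, and the point masses span a dense
    one. *)
Lemma bop_ext T S : bounded_operator T -> bounded_operator S ->
  (forall x, T (delta x) = S (delta x)) -> forall xi, T xi = S xi.
Proof.
move=> bT bS H; apply: dense_ind => [|a x eta IH|xi Hxi].
- by rewrite (bop0 bT) (bop0 bS).
- by rewrite (bopD bT) (bopD bS) (bopZ bT) (bopZ bS) H IH.
have [M [M0 HM]] := bop_bound (bop_sub bT bS).
apply/eqP; rewrite -subr_eq0; apply/eqP; apply: l2norm_small => e e0.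
have [eta Heta le_eta] := Hxi (e / M) (divr_gt0 e0 M0).
have -> : T xi - S xi = T (xi - eta) - S (xi - eta).
  by rewrite (bopB bT) (bopB bS) Heta opprB addrA subrK.
by apply: le_trans (HM _) _; rewrite mulrC -ler_pdivlMr.
Qed.

Lemma l2cvg_unique (u : nat -> l2 R X) xi eta :
  l2cvg u xi -> l2cvg u eta -> xi = eta.
Proof.
move=> H1 H2; apply/eqP; rewrite -subr_eq0; apply/eqP; apply: l2norm_small => e e0.
have e2 : 0 < e / 2 by rewrite divr_gt0.
have [N1 h1] := H1 _ e2; have [N2 h2] := H2 _ e2.
apply: le_trans (l2norm_tri (u (maxn N1 N2)) _ _) _; rewrite [e]splitr lerD//.
  by rewrite h1 ?leq_maxl.
by rewrite l2normC h2 ?leq_maxr.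
Qed.

Lemma bop_cvg T (u : nat -> l2 R X) xi : bounded_operator T ->
  l2cvg u xi -> l2cvg (T \o u) (T xi).
Proof.
move=> bT H e e0; have [M [M0 HM]] := bop_bound bT.
have [N HN] := H _ (divr_gt0 e0 M0); exists N => n Nn /=.
by rewrite -(bopB bT); apply: le_trans (HM _) _; rewrite mulrC -ler_pdivlMr// HN.
Qed.

Lemma l2cvg_norm (u : nat -> l2 R X) xi (r : R) : l2cvg u xi ->
  (forall e : R, 0 < e -> exists N, forall n, (N <= n)%N -> l2norm (u n) <= r + e) ->
  l2norm xi <= r.
Proof.
move=> H Hr; apply/ler_addgt0Pl => e e0; have e2 : 0 < e / 2 by rewrite divr_gt0.
have [N1 h1] := H _ e2; have [N2 h2] := Hr _ e2.
have := h1 (maxn N1 N2) (leq_maxl _ _); have := h2 (maxn N1 N2) (leq_maxr _ _).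
have := l2norm_tri (u (maxn N1 N2)) xi 0; rewrite !subr0; lra.
Qed.

Lemma dot_cvg0 (u : nat -> l2 R X) xi eta : l2cvg u xi ->
  (forall n, dot (u n) eta = 0) -> dot xi eta = 0.
Proof.
move=> H H0; suff abs0 : Num.sqrt (abs2 (dot xi eta)) = 0.
  by apply: abs2_eq0; apply/eqP; rewrite eq_le abs2_ge0 andbT -sqrtr_eq0 abs0.
apply/eqP; rewrite eq_le sqrtr_ge0 andbT; apply/ler_addgt0Pl => e e0.
rewrite addr0; have n0 : 0 < l2norm eta + 1 by rewrite ltr_wpDl ?l2norm_ge0.
have [N HN] := H _ (divr_gt0 e0 n0).
rewrite -[dot xi eta]subr0 -(H0 N) -dotBl; apply: le_trans (CS _ _) _.
have := HN N (leqnn N); rewrite ler_pdivlMr//; apply: le_trans.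
by rewrite ler_wpM2l ?l2norm_ge0// lerDl.
Qed.

Lemma nsq_parallelogram xi eta :
  nsq (xi + eta) + nsq (xi - eta) = 2 * nsq xi + 2 * nsq eta.
Proof. by rewrite nsqB nsqD; ring. Qed.

Section Projection.
Variable N : set (l2 R X).
Hypothesis N0 : N 0.
Hypothesis NL : forall a xi eta, N xi -> N eta -> N (a *: xi + eta).
Hypothesis Ncl : forall u xi, (forall n, N (u n)) -> l2cvg u xi -> N xi.

Lemma subspaceD xi eta : N xi -> N eta -> N (xi + eta).
Proof. by move=> /(NL 1) H /H; rewrite scale1r. Qed.

Lemma subspaceZ a xi : N xi -> N (a *: xi).
Proof. by move=> Nx; have := NL a Nx N0; rewrite addr0. Qed.

Lemma subspaceB xi eta : N xi -> N eta -> N (xi - eta).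
Proof. by move=> Nx /(subspaceZ (-1)); rewrite scaleN1r; apply: subspaceD. Qed.

(** A minimizing sequence is Cauchy by the parallelogram identity, because midpoints
    stay in N. *)
Lemma proj_near xi : exists2 zeta, N zeta &
  forall eta, N eta -> nsq (xi - zeta) <= nsq (xi - eta).
Proof.
pose D := [set nsq (xi - z) | z in N].
have D0 : has_inf D.
  split; first by exists (nsq (xi - 0)); exists 0.
  by exists 0 => _ [z _ <-]; apply: nsq_ge0.
pose d := inf D.
have dle z : N z -> d <= nsq (xi - z).
  by move=> Nz; apply: ge_inf; [case: D0|exists z].
have d0 : 0 <= d by apply: lb_le_inf; [case: D0|move=> _ [z _ <-]; apply: nsq_ge0].
have uP (n : nat) : exists z, N z /\ nsq (xi - z) < d + n.+1%:R^-1.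
  have [|_ [z Nz <-] H] := @inf_adherent _ D n.+1%:R^-1 _ D0; first by rewrite invr_gt0.
  by exists z.
have [u uH] := choice uP.
have uN n : N (u n) by case: (uH n).
have uC : l2cauchy u.
  move=> e e0.
  have [M _ HM] := near_infty_natSinv_lt (PosNum (divr_gt0 (exprn_gt0 2 e0) (ltr0n _ 4))).
  exists M => m n Mm Mn; rewrite l2norm_le ?(ltW e0)//.
  have := nsq_parallelogram (xi - u m) (xi - u n).
  have -> : xi - u m - (xi - u n) = u n - u m by rewrite opprB addrC addrA subrK.
  rewrite -[u n - u m]opprB nsqN.
  (* The midpoint of u m and u n lies in N, so its distance to xi is at least d. *)
  have hC : (Complex 2 0 : R[i]) != 0 by rewrite eq_complex /= pnatr_eq0.
  have Nm : N ((Complex 2 0)^-1 *: (u m + u n)).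
    by apply: subspaceZ; apply: subspaceD.
  have -> : xi - u m + (xi - u n) =
      Complex 2 0 *: (xi - (Complex 2 0)^-1 *: (u m + u n)).
    rewrite scalerBr scalerA mulfV// scale1r.
    have -> : (Complex 2 0 : R[i]) = 1 + 1.
      by apply/eqP; rewrite eq_complex /= addr0 !eqxx.
    by rewrite scalerDl scale1r addrACA opprD.
  rewrite nsqZ; have -> : abs2 (Complex 2 0 : R[i]) = 4 by rewrite /abs2/=; ring.
  have := dle _ Nm; case: (uH m) => _ h1; case: (uH n) => _ h2.
  have := HM m Mm; have := HM n Mn; rewrite /=.
  move: h1 h2.
  move: (nsq _) (nsq _) (nsq _) (nsq _) (m.+1%:R^-1) (n.+1%:R^-1) (e^+2) => *; lra.
have [zeta uz] := l2_complete uC.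
exists zeta; first exact: Ncl uz.
move=> eta Neta; apply: le_trans (dle _ Neta).
rewrite -[d]sqr_sqrtr// -l2norm_le ?sqrtr_ge0//.
apply: (@l2cvg_norm (fun n => xi - u n)).
  move=> e /uz[M HM]; exists M => n Mn.
  by rewrite opprB addrC addrA subrK l2normC HM.
move=> e e0.
have [M _ HM] := near_infty_natSinv_lt (PosNum (exprn_gt0 2 e0)).
exists M => n Mn; rewrite l2norm_le ?addr_ge0 ?sqrtr_ge0 ?(ltW e0)//.
case: (uH n) => _ /ltW h; apply: le_trans h _.
rewrite sqrrD sqr_sqrtr//; have := HM n Mn; rewrite /=.
have : 0 <= Num.sqrt d * e by rewrite mulr_ge0 ?sqrtr_ge0 ?ltW.
by move: (n.+1%:R^-1) (_ * e) => *; lra.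
Qed.

(** First-order optimality: moving the nearest point by a real multiple of eta, and
    then of i eta, cannot decrease the distance. *)
Lemma proj_orth xi zeta : N zeta ->
  (forall eta, N eta -> nsq (xi - zeta) <= nsq (xi - eta)) ->
  forall eta, N eta -> dot (xi - zeta) eta = 0.
Proof.
move=> Nz Hz.
have re0 eta : N eta -> re (dot (xi - zeta) eta) = 0.
  move=> Ne; set d := re _.
  have H (t : R) : 0 <= - (2 * t * d) + t ^+ 2 * nsq eta.
    have := Hz _ (subspaceD Nz (subspaceZ (Complex t 0) Ne)).
    rewrite opprD addrA (nsqB (xi - zeta)) dotZr nsqZ.
    have -> : re (conjc (Complex t 0) * dot (xi - zeta) eta) = t * d.
      by rewrite reM /= oppr0 oppr0 mul0r addr0.
    have -> : abs2 (Complex t 0 : R[i]) = t ^+ 2 by rewrite /abs2 /= expr0n addr0.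
    by move: (nsq _) (nsq _) => *; lra.
  have n1 : 0 < nsq eta + 1 by rewrite ltr_wpDl ?nsq_ge0.
  have := H (d / (nsq eta + 1)).
  have -> : - (2 * (d / (nsq eta + 1)) * d) + (d / (nsq eta + 1)) ^+ 2 * nsq eta =
     - (d ^+ 2 * (nsq eta + 2) / (nsq eta + 1) ^+ 2).
    by field; rewrite gt_eqF.
  rewrite oppr_ge0 pmulr_lle0 ?invr_gt0 ?exprn_gt0// pmulr_lle0.
    by move=> dle; apply/eqP; rewrite -sqrf_eq0 eq_le dle sqr_ge0.
  by rewrite ltr_wpDl ?nsq_ge0.
move=> eta Ne; apply/eqP; rewrite eq_complex re0// eqxx /=.
have := re0 _ (subspaceZ (Complex 0 1) Ne); rewrite dotZr reM /=.
by rewrite mul0r add0r opprK mul1r => ->.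
Qed.

Lemma proj_unique zeta zeta' xi : N zeta -> N zeta' ->
  (forall eta, N eta -> dot (xi - zeta) eta = 0) ->
  (forall eta, N eta -> dot (xi - zeta') eta = 0) -> zeta = zeta'.
Proof.
move=> Nz Nz' H H'; apply/eqP; rewrite -subr_eq0; apply/eqP; apply: nsq_eq0.
have Nd : N (zeta - zeta') by exact: subspaceB.
rewrite nsq_dot {1}(_ : zeta - zeta' = (xi - zeta') - (xi - zeta)).
  by rewrite dotBl H// H'// subr0.
by rewrite opprB [RHS]addrC addrA subrK.
Qed.

Lemma projection : exists P : operator R X, [/\ bounded_operator P,
  forall xi, N (P xi) & forall xi eta, N eta -> dot (xi - P xi) eta = 0].
Proof.
have PP xi : exists z, N z /\ forall eta, N eta -> dot (xi - z) eta = 0.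
  have [z Nz Hz] := proj_near xi; exists z; split=> //; exact: proj_orth.
have [P HP] := choice PP.
have NP xi : N (P xi) by case: (HP xi).
have OP xi eta : N eta -> dot (xi - P xi) eta = 0.
  by case: (HP xi) => _; apply.
exists P; split=> //; split=> [a xi eta|].
  apply: (@proj_unique _ _ (a *: xi + eta)) => //.
  - by apply: NL.
  - by move=> z Nz; apply: OP.
  - move=> z Nz.
    have -> : a *: xi + eta - (a *: P xi + P eta) =
       a *: (xi - P xi) + (eta - P eta).
      by rewrite scalerBr opprD addrACA.
    by rewrite dotDl dotZl !OP// mulr0 addr0.
exists 1 => xi; rewrite mul1r l2norm_le ?l2norm_ge0// l2norm_sqr.
rewrite -{2}[xi](subrK (P xi)) nsqD OP//= mulr0 addr0 lerDr.
exact: nsq_ge0.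
Qed.

End Projection.

End BoundedOperators.

(** * Slices, amplifications and tensor products of operators *)

Section Amplification.
Variables (R : realType) (X J : choiceType).
Implicit Types (zeta : l2 R (X * J)%type) (T S : operator R X).

Lemma sqnorm_slices (f : X * J -> R[i]) :
  sqnorm f = \esum_(j in [set: J]) sqnorm (fun x => f (x, j)).
Proof.
pose sw (p : J * X) := (p.2, p.1).
have bsw : bijective sw by exists (fun p => (p.2, p.1)) => -[].
rewrite /sqnorm (esum_bij _ bsw).
rewrite (esum_pair (g := fun p => abs2 (f (sw p))))// => p; exact: abs2_ge0.
Qed.

Lemma slice_subproof zeta j : (fun x => zeta (x, j)) \in @sqsummable R X.
Proof.
have := l2P zeta; rewrite !inE sqnorm_slices; apply: le_lt_trans.
apply: (esum_ge_term (g := fun j => sqnorm (fun x => zeta (x, j)))).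
exact: sqnorm_ge0.
Qed.

(** Vectors on X * J are treated as square-summable J-families of vectors on X. *)
Definition slice zeta j : l2 R X := L2 (slice_subproof zeta j).

Lemma sliceE zeta j x : slice zeta j x = zeta (x, j). Proof. by []. Qed.

Lemma slice_linear a zeta zeta' j :
  slice (a *: zeta + zeta') j = a *: slice zeta j + slice zeta' j.
Proof. exact: l2_ext. Qed.

Lemma sliceB zeta zeta' j :
  slice (zeta - zeta') j = slice zeta j - slice zeta' j.
Proof. exact: l2_ext. Qed.

Lemma slice_ext zeta zeta' : (forall j, slice zeta j = slice zeta' j) ->
  zeta = zeta'.
Proof.
by move=> H; apply: l2_ext => -[x j]; rewrite -!sliceE H.
Qed.

Lemma esum_nsq_slice zeta :
  (\esum_(j in [set: J]) (nsq (slice zeta j))%:E = (nsq zeta)%:E)%E.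
Proof.
rewrite -sqnormE sqnorm_slices; apply: eq_esum => j _.
by rewrite -sqnormE.
Qed.

Lemma slice_rsummable zeta : rsummable (fun j => nsq (slice zeta j)).
Proof.
rewrite /rsummable; under eq_esum do rewrite ger0_norm ?nsq_ge0//.
by rewrite esum_nsq_slice ltry.
Qed.

Lemma nsq_slice_le zeta j : nsq (slice zeta j) <= nsq zeta.
Proof.
rewrite -lee_fin -esum_nsq_slice.
by apply: (esum_ge_term (g := fun j => (nsq (slice zeta j))%:E)); rewrite lee_fin nsq_ge0.
Qed.

Lemma glue_subproof (F : J -> l2 R X) : rsummable (fun j => nsq (F j)) ->
  (fun p : X * J => F p.2 p.1) \in @sqsummable R (X * J)%type.
Proof.
rewrite /rsummable; under eq_esum do rewrite ger0_norm ?nsq_ge0// -sqnormE.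
by rewrite inE /= sqnorm_slices.
Qed.

Definition glue (F : J -> l2 R X) (HF : rsummable (fun j => nsq (F j))) :
  l2 R (X * J)%type := L2 (glue_subproof HF).

Lemma slice_glue F HF j : slice (@glue F HF) j = F j.
Proof. exact: l2_ext. Qed.

Lemma dot_slices zeta zeta' :
  dot zeta zeta' = csum (fun j => dot (slice zeta j) (slice zeta' j)).
Proof.
pose sw (p : J * X) := (p.2, p.1).
have bsw : bijective sw by exists (fun p => (p.2, p.1)) => -[].
rewrite dotE (csum_bij _ bsw) csum_pair.
  by congr csum; apply/funext => j; rewrite dotE.
have [f1 f2] := dot_csummable zeta zeta'.
by split; rewrite /rsummable; [move: f1|move: f2]; rewrite /rsummable (esum_bij _ bsw).
Qed.

Lemma dot_slices_csummable zeta zeta' :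
  csummable (fun j => dot (slice zeta j) (slice zeta' j)).
Proof.
apply: (csummable_le (g := fun j => nsq (slice zeta j) + nsq (slice zeta' j))).
  by apply: rsummableD; apply: slice_rsummable.
move=> j; have := CS (slice zeta j) (slice zeta' j).
have := abs_re_le (dot (slice zeta j) (slice zeta' j)).
have := abs_im_le (dot (slice zeta j) (slice zeta' j)).
rewrite -!l2norm_sqr; move: (l2norm _) (l2norm _) => a b.
move: (Num.sqrt _) `|_| `|_| => m p q qm pm mab.
have := sqr_ge0 (a - b); have := sqr_ge0 a; have := sqr_ge0 b.
by split; nra.
Qed.

Lemma slice_tens (xi : l2 R X) (eta : l2 R J) j :
  slice (tens xi eta) j = eta j *: xi.
Proof. by apply: l2_ext => x; rewrite sliceE l2ZE mulrC. Qed.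

Lemma tens_delta (x : X) (j : J) :
  tens (delta x) (delta j) = delta (x, j) :> l2 R (X * J)%type.
Proof.
apply: l2_ext => -[y k]; rewrite /= xpair_eqE.
by case: (y == x); case: (k == j); rewrite ?mulr1 ?mulr0 ?mul0r.
Qed.

Lemma nsq_tens (xi : l2 R X) (eta : l2 R J) :
  nsq (tens xi eta) = nsq xi * nsq eta.
Proof.
apply: EFin_inj; rewrite -esum_nsq_slice EFinM -(sqnormE eta) /sqnorm -esumZ.
- by apply: eq_esum => j _; rewrite slice_tens nsqZ mulrC.
- exact: nsq_ge0.
- by move=> j; apply: abs2_ge0.
Qed.

Lemma ampl_subproof T (bT : bounded_operator T) zeta :
  rsummable (fun j => nsq (T (slice zeta j))).
Proof.
have [M [M0 HM]] := bop_bound bT.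
apply: le_rsummable (rsummableZ (M ^+ 2) (slice_rsummable zeta)) _ => j.
have M0' := ltW M0.
rewrite !ger0_norm ?mulr_ge0 ?nsq_ge0// -!l2norm_sqr -exprMn.
by rewrite ler_sqr ?nnegrE ?l2norm_ge0// mulr_ge0 ?l2norm_ge0 ?ltW.
Qed.

(** T tensored with the identity. Acting slice by slice defines it on all of the
    Hilbert space tensor product, not only on elementary tensors. *)
Definition ampl T (bT : bounded_operator T) : operator R (X * J)%type :=
  fun zeta => glue (ampl_subproof bT zeta).

Lemma slice_ampl T bT zeta j : slice (@ampl T bT zeta) j = T (slice zeta j).
Proof. by rewrite slice_glue. Qed.

Lemma ampl_bound T bT (M : R) : 0 <= M ->
  (forall xi, l2norm (T xi) <= M * l2norm xi) ->
  forall zeta, l2norm (@ampl T bT zeta) <= M * l2norm zeta.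
Proof.
move=> M0 HM zeta; rewrite l2norm_le ?mulr_ge0 ?l2norm_ge0//.
rewrite exprMn l2norm_sqr -lee_fin EFinM -!esum_nsq_slice -esumZ.
- apply: le_esum => j _; rewrite slice_ampl lee_fin -!l2norm_sqr -exprMn.
  by rewrite ler_sqr ?nnegrE ?l2norm_ge0// mulr_ge0 ?l2norm_ge0.
- exact: sqr_ge0.
- by move=> j; apply: nsq_ge0.
Qed.

Lemma bop_ampl T bT : bounded_operator (@ampl T bT).
Proof.
split=> [a zeta zeta'|].
  apply: slice_ext => j; rewrite slice_linear !slice_ampl slice_linear.
  by rewrite (bopD bT) (bopZ bT).
have [M [M0 HM]] := bop_bound bT; exists M; apply: ampl_bound => //.
exact: ltW.
Qed.

Lemma ampl_tens T bT xi (eta : l2 R J) :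
  @ampl T bT (tens xi eta) = tens (T xi) eta.
Proof.
by apply: slice_ext => j; rewrite slice_ampl !slice_tens (bopZ bT).
Qed.

Lemma ampl_adj T S bT bS :
  (forall xi eta, dot (T xi) eta = dot xi (S eta)) ->
  forall zeta zeta', dot (@ampl T bT zeta) zeta' = dot zeta (@ampl S bS zeta').
Proof.
move=> H zeta zeta'; rewrite !dot_slices; congr csum; apply/funext => j.
by rewrite !slice_ampl.
Qed.

End Amplification.

Section TensorOperators.
Variables (R : realType).

Lemma swap_subproof (X Y : choiceType) (zeta : l2 R (X * Y)%type) :
  (fun p => zeta (p.2, p.1)) \in @sqsummable R (Y * X)%type.
Proof.
pose sw (p : Y * X) := (p.2, p.1).
have bsw : bijective sw by exists (fun p => (p.2, p.1)) => -[].
have := l2P zeta; rewrite !inE /sqnorm (esum_bij _ bsw)//.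
Qed.

Definition swap (X Y : choiceType) (zeta : l2 R (X * Y)%type) :
  l2 R (Y * X)%type := L2 (swap_subproof zeta).

Lemma swap_linear (X Y : choiceType) a (zeta zeta' : l2 R (X * Y)%type) :
  swap (a *: zeta + zeta') = a *: swap zeta + swap zeta'.
Proof. exact: l2_ext. Qed.

Lemma swapB (X Y : choiceType) (zeta zeta' : l2 R (X * Y)%type) :
  swap (zeta - zeta') = swap zeta - swap zeta'.
Proof. exact: l2_ext. Qed.

Lemma swapK (X Y : choiceType) (zeta : l2 R (X * Y)%type) : swap (swap zeta) = zeta.
Proof. by apply: l2_ext => -[]. Qed.

Lemma swap_tens (X Y : choiceType) (xi : l2 R X) (eta : l2 R Y) :
  swap (tens xi eta) = tens eta xi.
Proof. by apply: l2_ext => -[y x]; rewrite /= mulrC. Qed.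

Lemma dot_swap (X Y : choiceType) (zeta zeta' : l2 R (X * Y)%type) :
  dot (swap zeta) (swap zeta') = dot zeta zeta'.
Proof.
pose sw (p : X * Y) := (p.2, p.1).
have bsw : bijective sw by exists (fun p => (p.2, p.1)) => -[].
by rewrite !dotE (csum_bij _ bsw); congr csum; apply/funext => -[].
Qed.

Lemma l2norm_swap (X Y : choiceType) (zeta : l2 R (X * Y)%type) :
  l2norm (swap zeta) = l2norm zeta.
Proof. by rewrite !l2normE !nsq_dot dot_swap. Qed.

Variables X Y : choiceType.
Implicit Types (zeta : l2 R (X * Y)%type).

(** The identity tensored with T. *)
Definition ampr (T : operator R Y) (bT : bounded_operator T) :
    operator R (X * Y)%type :=
  fun zeta => swap (ampl bT (swap zeta)).

Lemma ampr_tens T bT xi eta : @ampr T bT (tens xi eta) = tens xi (T eta).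
Proof. by rewrite /ampr swap_tens ampl_tens swap_tens. Qed.

Lemma ampr_bound T bT (M : R) : 0 <= M ->
  (forall xi, l2norm (T xi) <= M * l2norm xi) ->
  forall zeta, l2norm (@ampr T bT zeta) <= M * l2norm zeta.
Proof.
move=> M0 HM zeta; rewrite l2norm_swap -(l2norm_swap zeta).
exact: ampl_bound.
Qed.

Lemma bop_ampr T bT : bounded_operator (@ampr T bT).
Proof.
split=> [a zeta zeta'|].
  rewrite /ampr swap_linear (bopD (bop_ampl _ bT)) (bopZ (bop_ampl _ bT)).
  by rewrite swap_linear.
have [M [M0 HM]] := bop_bound bT; exists M; apply: ampr_bound => //.
exact: ltW.
Qed.

Lemma ampr_adj T S bT bS :
  (forall xi eta, dot (T xi) eta = dot xi (S eta)) ->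
  forall zeta zeta', dot (@ampr T bT zeta) zeta' = dot zeta (@ampr S bS zeta').
Proof.
move=> H zeta zeta'; rewrite /ampr -[zeta']swapK dot_swap.
by rewrite (ampl_adj _ bS H) swapK -dot_swap swapK.
Qed.

Lemma bop_ext_tens (U V : operator R (X * Y)%type) :
  bounded_operator U -> bounded_operator V ->
  (forall xi eta, U (tens xi eta) = V (tens xi eta)) -> forall zeta, U zeta = V zeta.
Proof.
by move=> bU bV H; apply: bop_ext => // -[x y]; rewrite -tens_delta H.
Qed.

(** Elementary tensors of point masses are the point masses, so at most one bounded
    operator has the values prescribed for the tensor product; the composite of the
    two amplifications has them. *)
Lemma tensopE (S : operator R X) (T : operator R Y)
    (bS : bounded_operator S) (bT : bounded_operator T) :
  tensop S T = ampl bS \o ampr bT.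
Proof.
rewrite /tensop; case: xgetP => [U _ [bU HU]|/(_ (ampl bS \o ampr bT)) H].
  apply/funext; apply: bop_ext_tens => //.
    by apply: bop_comp; [apply: bop_ampl|apply: bop_ampr].
  by move=> xi eta; rewrite HU /= ampr_tens ampl_tens.
exfalso; apply: H; split.
  by apply: bop_comp; [apply: bop_ampl|apply: bop_ampr].
by move=> xi eta; rewrite /= ampr_tens ampl_tens.
Qed.

Lemma ampl_ampr (S : operator R X) (T : operator R Y) bS bT zeta :
  @ampl R X Y S bS (@ampr T bT zeta) = ampr bT (ampl bS zeta).
Proof.
pose U := @ampl R X Y S bS \o @ampr T bT.
pose V := @ampr T bT \o @ampl R X Y S bS.
apply: (@bop_ext_tens U V).
- by apply: bop_comp; [apply: bop_ampl|apply: bop_ampr].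
- by apply: bop_comp; [apply: bop_ampr|apply: bop_ampl].
by move=> xi eta; rewrite /U /V /= ampr_tens !ampl_tens ampr_tens.
Qed.

End TensorOperators.

(** * The group von Neumann algebra *)

Section GroupVonNeumann.
Variables (R : realType) (G : groupType).
Implicit Types (xi eta : l2 R G) (s t : G) (T : operator R G).

Local Notation lam := (@lambda R G).
Local Notation LG := (range lam).

Lemma lambdaE s xi t : lam s xi t = xi (s^-1 * t)%g. Proof. by []. Qed.

Lemma bij_mulg s : bijective (fun t : G => s * t)%g.
Proof. by exists (fun t => s^-1 * t)%g => t /=; rewrite ?mulKg ?mulVKg. Qed.

Lemma dot_lambda s xi eta : dot (lam s xi) eta = dot xi (lam s^-1%g eta).
Proof.
rewrite !dotE (csum_bij _ (bij_mulg s)); congr csum; apply/funext => t.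
by rewrite !lambdaE mulKg invgK.
Qed.

Lemma lambda1 xi : lam 1%g xi = xi.
Proof. by apply: l2_ext => t; rewrite lambdaE invg1 mul1g. Qed.

Lemma lambdaM s t xi : lam s (lam t xi) = lam (s * t)%g xi.
Proof. by apply: l2_ext => u; rewrite !lambdaE invgM mulgA. Qed.

Lemma l2norm_lambda s xi : l2norm (lam s xi) = l2norm xi.
Proof. by rewrite !l2normE !nsq_dot dot_lambda lambdaM mulVg lambda1. Qed.

Lemma bop_lambda s : bounded_operator (lam s).
Proof.
split=> [a xi eta|]; first exact: l2_ext.
by exists 1 => xi; rewrite l2norm_lambda mul1r.
Qed.

Lemma lambda_delta s t : lam s (delta t) = delta (s * t)%g.
Proof.
apply: l2_ext => u; rewrite lambdaE !deltaE; congr (nat_of_bool _)%:R.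
by apply/eqP/eqP => [<-|->]; rewrite ?mulVKg ?mulKg.
Qed.

Lemma VN_bop T : VN T -> bounded_operator T. Proof. by case. Qed.

Lemma VN_lambda s : VN (lam s).
Proof. by split=> [|S [_ /(_ (lam s)) H]]; [exact: bop_lambda|rewrite -H//; exists s]. Qed.

Lemma VN_comp T S : VN T -> VN S -> VN (T \o S).
Proof.
move=> [bT HT] [bS HS]; split; first exact: bop_comp.
by move=> U cU; rewrite -compA HS// [LHS]compA HT.
Qed.

Lemma rho_subproof t xi : (fun u => xi (u * t)%g) \in @sqsummable R G.
Proof.
have br : bijective (fun u : G => u * t)%g.
  by exists (fun u => u * t^-1)%g => u /=; rewrite ?mulgK ?mulgVK.
by have := l2P xi; rewrite !inE /sqnorm (esum_bij _ br).
Qed.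

(** The right regular representation. *)
Definition rho t : operator R G := fun xi => L2 (rho_subproof t xi).

Lemma dot_rho t xi eta : dot (rho t xi) (rho t eta) = dot xi eta.
Proof.
have br : bijective (fun u : G => u * t)%g.
  by exists (fun u => u * t^-1)%g => u /=; rewrite ?mulgK ?mulgVK.
by rewrite !dotE [RHS](csum_bij _ br).
Qed.

Lemma l2norm_rho t xi : l2norm (rho t xi) = l2norm xi.
Proof. by rewrite !l2normE !nsq_dot dot_rho. Qed.

Lemma rho_delta t u : rho t (delta u) = delta (u * t^-1)%g.
Proof.
apply: l2_ext => v; rewrite /= ; congr (nat_of_bool _)%:R.
by apply/eqP/eqP => [<-|->]; rewrite ?mulgK ?mulgVK.
Qed.

Lemma rho_commutant t : commutant LG (rho t).
Proof.
split; first split=> [a xi eta|]; first exact: l2_ext.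
  by exists 1 => xi; rewrite l2norm_rho mul1r.
move=> _ [s _ <-]; apply/funext => xi; apply: l2_ext => u /=.
by rewrite mulgA.
Qed.

Lemma VN_rho T t xi : VN T -> T (rho t xi) = rho t (T xi).
Proof.
by move=> [_ /(_ _ (rho_commutant t))/(congr1 (fun f => f xi))].
Qed.

Section DoubleCommutant.
Variable J : choiceType.
Implicit Types zeta : l2 R (G * J)%type.

Let lamJ s := @ampl R G J (lam s) (bop_lambda s).

Lemma ampl_lambdaM s t zeta : lamJ s (lamJ t zeta) = lamJ (s * t)%g zeta.
Proof. by apply: slice_ext => j; rewrite !slice_ampl lambdaM. Qed.

Lemma dot_ampl_lambda s zeta zeta' :
  dot (lamJ s zeta) zeta' = dot zeta (lamJ s^-1%g zeta').
Proof. by apply: ampl_adj => xi eta; apply: dot_lambda. Qed.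

(** The double commutant argument: the vectors z whose whole orbit under the amplified
    lambda(s) is orthogonal to zeta' form a closed subspace, invariant under these
    unitaries. The projection P onto it commutes with them, so its matrix entries lie
    in the commutant of lambda(G) and T commutes with each of them. Hence the amplification
    of T commutes with P and preserves the subspace. *)
Lemma double_commutant zeta zeta' : (forall s, dot (lamJ s zeta) zeta' = 0) ->
  forall T (vT : VN T), dot (ampl (VN_bop vT) zeta) zeta' = 0.
Proof.
move=> H T vT; set TJ := ampl _.
have bTJ : bounded_operator TJ by exact: bop_ampl.
have blJ s : bounded_operator (lamJ s) by exact: bop_ampl.
pose N : set (l2 R (G * J)%type) := [set z | forall s, dot (lamJ s z) zeta' = 0].
have N0 : N 0 by move=> s; rewrite (bop0 (blJ s)) dot0l.
have NL a z z' : N z -> N z' -> N (a *: z + z').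
  move=> h h' s; rewrite (bopD (blJ s)) (bopZ (blJ s)) dotDl dotZl h h'.
  by rewrite mulr0 addr0.
have Ncl (u : nat -> l2 R (G * J)%type) z : (forall n, N (u n)) -> l2cvg u z -> N z.
  move=> Nu uz s; apply: (dot_cvg0 (bop_cvg (blJ s) uz)) => n /=.
  exact: Nu.
have [P [bP NP OP]] := projection N0 NL Ncl.
have Nlam s z : N z -> N (lamJ s z) by move=> h t; rewrite ampl_lambdaM h.
have Plam s z : P (lamJ s z) = lamJ s (P z).
  apply: (proj_unique N0 NL (xi := lamJ s z)) => //; first exact: Nlam.
  - by move=> z' Nz'; apply: OP.
  - move=> z' Nz'; rewrite -(bopB (blJ s)) dot_ampl_lambda.
    by apply: OP; apply: Nlam.
have PT z : P (TJ z) = TJ (P z).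
  apply: (@bop_ext _ _ (P \o TJ) (TJ \o P)); do ?exact: bop_comp.
  move=> [x i] /=; rewrite -tens_delta /TJ ampl_tens.
  apply: slice_ext => j; rewrite slice_ampl.
  (* The (j, i) matrix entry of P, an operator on l2(G). *)
  pose Pij : operator R G := fun xi => slice (P (tens xi (delta i))) j.
  suff /(congr1 (fun f => f (delta x))) : T \o Pij = Pij \o T by [].
  have tensL a xi eta : tens (a *: xi + eta) (delta i) =
      a *: tens xi (delta i) + tens eta (delta i) :> l2 R (G * J)%type.
    apply: l2_ext => p; rewrite l2DE l2ZE;
    change ((a * xi p.1 + eta p.1) * delta i p.2 =
      a * (xi p.1 * delta i p.2) + eta p.1 * delta i p.2).
    by rewrite mulrDl mulrA.
  case: (vT) => _; apply; split; last first.
    move=> _ [s _ <-]; apply/funext => xi; rewrite /Pij /=.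
    by rewrite -(ampl_tens (bop_lambda s)) Plam slice_ampl.
  split=> [a xi eta|].
    by rewrite /Pij tensL (bopD bP) (bopZ bP) slice_linear.
  have [M [M0 HM]] := bop_bound bP; exists M => xi.
  have -> : l2norm xi = l2norm (tens xi (delta i : l2 R J)).
    by rewrite !l2normE nsq_tens nsq_delta mulr1.
  apply: le_trans (HM _); rewrite l2norm_le ?l2norm_ge0// l2norm_sqr.
  exact: nsq_slice_le.
have Pzeta : P zeta = zeta.
  apply: (proj_unique N0 NL (xi := zeta)) => // z Nz; last by rewrite subrr dot0l.
  exact: OP.
have := NP (TJ zeta) 1%g; rewrite PT Pzeta.
suff -> : lamJ 1%g (TJ zeta) = TJ zeta by [].
by apply: slice_ext => j; rewrite slice_ampl lambda1.
Qed.

End DoubleCommutant.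

(** A normal functional on VN(G) is determined by its values on the translations. The
    difference between phi and the vector functional of xi, eta is again a sum of vector
    functionals, indexed by option nat with the extra index None carrying xi and eta; it
    is a single vector functional of an amplification, to which the double commutant
    argument applies. *)
Lemma normal_vector_functional (phi : operator R G -> R[i]) xi eta :
  normal_functional (@VN R G) phi -> (forall s, phi (lam s) = dot (lam s xi) eta) ->
  forall T, VN T -> phi T = dot (T xi) eta.
Proof.
move=> [xs [es [xsS esS phiE]]] H T vT.
pose F o := if o is Some n then - xs n else xi.
pose E o := if o is Some n then es n else eta.
have sumO (H' : option nat -> l2 R G) :
    (\esum_(n in [set: nat]) (l2norm (H' (Some n)) ^+ 2)%:E < +oo)%E ->
    rsummable (fun o => nsq (H' o)).
  move=> h; rewrite /rsummable esum_option => [|o]; last by rewrite lee_fin.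
  rewrite lte_add_pinfty ?ltry//; under eq_esum do rewrite ger0_norm ?nsq_ge0//.
  by under eq_esum do rewrite -l2norm_sqr.
have FS : rsummable (fun o => nsq (F o)).
  by apply: sumO; under eq_esum do rewrite /= l2normN.
have ES : rsummable (fun o => nsq (E o)) by exact: sumO.
have key S (bS : bounded_operator S) : VN S ->
    dot (ampl bS (glue FS)) (glue ES) = dot (S xi) eta - phi S.
  move=> vS.
  have SE n : dot (slice (ampl bS (glue FS)) (Some n)) (slice (glue ES) (Some n)) =
      -1 * dot (S (xs n)) (es n).
    by rewrite slice_ampl !slice_glue /= (bopN bS) dotNl mulN1r.
  have [r1 r2] := dot_slices_csummable (ampl bS (glue FS)) (glue ES).
  have Ssum : csummable (fun n : nat => dot (slice (ampl bS (glue FS)) (Some n))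
                                            (slice (glue ES) (Some n))).
    split; [move: r1|move: r2]; rewrite /rsummable esum_option//;
    by apply: le_lt_trans; rewrite leeDr.
  rewrite dot_slices csum_option// slice_ampl !slice_glue /= phiE//; congr (_ + _).
  rewrite -mulN1r -csumZ.
    by congr csum; apply/funext => n; rewrite SE.
  have := csummableZ (-1) Ssum; congr csummable; apply/funext => n.
  by rewrite SE mulN1r mulN1r opprK.
have := @double_commutant _ (glue FS) (glue ES) _ T vT.
rewrite key// => K; apply/esym/eqP; rewrite -subr_eq0; apply/eqP; apply: K => s.
by rewrite key ?H ?subrr//; apply: VN_lambda.
Qed.

End GroupVonNeumann.

(** * Adjoints *)

Section Adjoint.
Variables (R : realType) (X : choiceType).
Implicit Types (xi eta zeta : l2 R X) (T S : operator R X).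

Definition cabs (z : R[i]) : R := Num.sqrt (abs2 z).

Lemma cabsD (z w : R[i]) : cabs (z + w) <= cabs z + cabs w.
Proof.
have := ler_normD z w; rewrite !normc_def -!/(abs2 _) -!/(cabs _).
by rewrite -rmorphD lecR.
Qed.

Lemma cabsN (z : R[i]) : cabs (- z) = cabs z.
Proof. by rewrite /cabs abs2N. Qed.

Lemma cabs_le0 (z : R[i]) : cabs z <= 0 -> z = 0.
Proof.
move=> z0; apply: abs2_eq0; apply/eqP; rewrite eq_le abs2_ge0 andbT -sqrtr_eq0.
by rewrite eq_le z0 sqrtr_ge0.
Qed.

(** By density of the finitely supported vectors. It serves to verify identities between
    sesquilinear expressions on point masses only. *)
Lemma bounded_functional0 (f : l2 R X -> R[i]) (M : R) :
  (forall a xi eta, f (a *: xi + eta) = a * f xi + f eta) ->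
  (forall xi, cabs (f xi) <= M * l2norm xi) ->
  (forall x, f (delta x) = 0) -> forall xi, f xi = 0.
Proof.
move=> fL fM fd.
have f0 : f 0 = 0.
  by apply: cabs_le0; have := fM 0; rewrite l2norm0 mulr0.
apply: dense_ind => [//|a x eta IH|xi H]; first by rewrite fL fd IH mulr0 addr0.
have M1 : 0 < `|M| + 1 by rewrite ltr_wpDl.
apply: cabs_le0; apply/ler_addgt0Pl => e e0; rewrite addr0.
have [eta feta xe] := H _ (divr_gt0 e0 M1).
have -> : f xi = f (xi - eta) by rewrite addrC -scaleN1r fL feta mulr0 add0r.
apply: le_trans (fM _) _; move: xe; rewrite ler_pdivlMr// mulrC; apply: le_trans.
by rewrite ler_wpM2r ?l2norm_ge0// ler_wpDr// ler_norm.
Qed.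

Lemma mulJ (z : R[i]) : z * conjc z = Complex (abs2 z) 0.
Proof.
case: z => a b; apply/eqP; rewrite eq_complex /abs2 /=.
by apply/andP; split; apply/eqP; ring.
Qed.

(** The x-th coordinate of the adjoint at eta must be the conjugate of the inner product
    of T (delta x) and eta. Testing T on the finite truncations of this family shows
    that it is square-summable. *)
Lemma adjoint_exists T : bounded_operator T ->
  exists S, forall xi eta, dot (T xi) eta = dot xi (S eta).
Proof.
move=> bT; have [M [M0 HM]] := bop_bound bT.
have c_sub eta : (fun x => conjc (dot (T (delta x)) eta)) \in @sqsummable R X.
  rewrite inE; apply: (@le_lt_trans _ _ ((M * l2norm eta) ^+ 2)%:E); last exact: ltry.
  apply: ge_ereal_sup => _ [A [finA _] <-].
  rewrite fsbig_finite//= sumEFin lee_fin.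
  set c := fun x => conjc (dot (T (delta x)) eta).
  set s := finmap.enum_fset _; set q := (X in X <= _).
  have q0 : 0 <= q by apply: sumr_ge0 => x _; apply: abs2_ge0.
  pose v := \sum_(x <- s) c x *: (delta x : l2 R X).
  have vq (f : l2 R X -> R[i]) : f 0 = 0 ->
      (forall a xi zeta, f (a *: xi + zeta) = a * f xi + f zeta) ->
      f v = \sum_(x <- s) c x * f (delta x).
    move=> f0 fL; rewrite /v; elim: (s) => [|x s' IH]; first by rewrite !big_nil.
    by rewrite !big_cons fL IH.
  have qC : \sum_(x <- s) c x * conjc (c x) = Complex q 0.
    rewrite /q; elim: (s) => [|x s' IH]; first by rewrite !big_nil.
    rewrite !big_cons IH mulJ; apply/eqP.
    by rewrite eq_complex reD imD /= addr0 !eqxx.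
  have Tv : dot (T v) eta = Complex q 0.
    rewrite (vq (fun xi => dot (T xi) eta)); first last.
    - by move=> a xi zeta; rewrite (bopD bT) (bopZ bT) dotDl dotZl.
    - by rewrite (bop0 bT) dot0l.
    by rewrite -qC; apply: eq_bigr => x _; rewrite /c conjcK.
  have vv : nsq v = q.
    have us : uniq s by exact: finmap.fset_uniq.
    rewrite nsq_dot (vq (fun xi => dot xi v)); first last.
    - by move=> a xi zeta; rewrite dotDl dotZl.
    - by rewrite dot0l.
    have -> : \sum_(x <- s) c x * dot (delta x) v = Complex q 0.
      rewrite -qC big_seq [RHS]big_seq; apply: eq_bigr => x xs; congr (_ * _).
      by rewrite dotC dot_delta /v truncE// xs.
    by [].
  have := CS_norm (T v) eta; rewrite Tv /= => qle.
  have {qle} : q <= M * l2norm v * l2norm eta.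
    by apply: le_trans qle _; rewrite ler_wpM2r ?l2norm_ge0.
  rewrite -{1}vv -l2norm_sqr mulrAC expr2.
  have [v0 _|v0] := eqVneq (l2norm v) 0.
    by rewrite -vv -l2norm_sqr v0 expr0n sqr_ge0.
  rewrite ler_pM2r; last by rewrite lt_def v0 l2norm_ge0.
  move=> vle; rewrite -vv -l2norm_sqr ler_sqr ?nnegrE ?l2norm_ge0//.
  by rewrite mulr_ge0 ?l2norm_ge0// ltW.
exists (fun eta => L2 (c_sub eta)) => xi eta; set S := L2 _.
apply/eqP; rewrite -subr_eq0; apply/eqP.
apply: (@bounded_functional0 (fun xi => dot (T xi) eta - dot xi S)
   (M * l2norm eta + l2norm S)).
- move=> a z z'; rewrite (bopD bT) (bopZ bT) !dotDl !dotZl; ring.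
- move=> z; apply: le_trans (cabsD _ _) _; rewrite cabsN mulrDl lerD//.
    apply: le_trans (CS _ _) _; rewrite mulrAC.
    by rewrite ler_wpM2r ?l2norm_ge0.
  by apply: le_trans (CS _ _) _; rewrite mulrC.
- by move=> x; rewrite (dotC S (delta x)) dot_delta /= conjcK subrr.
Qed.

Lemma adjP T : bounded_operator T ->
  forall xi eta, dot (T xi) eta = dot xi (adj T eta).
Proof.
move=> /adjoint_exists[S HS]; rewrite /adj.
by case: xgetP => [U _ //|/(_ S)].
Qed.

Lemma dot_ext xi eta : (forall zeta, dot zeta xi = dot zeta eta) -> xi = eta.
Proof.
move=> H; apply: l2_ext => x; rewrite -!dot_delta (dotC (delta x)) H.
by rewrite -(dotC (delta x)).
Qed.

Lemma adjP' T : bounded_operator T ->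
  forall xi eta, dot (adj T xi) eta = dot xi (T eta).
Proof. by move=> bT xi eta; rewrite dotC -(adjP bT) -dotC. Qed.

Lemma adj_bound T (M : R) : bounded_operator T ->
  (forall xi, l2norm (T xi) <= M * l2norm xi) ->
  forall xi, l2norm (adj T xi) <= M * l2norm xi.
Proof.
move=> bT HM xi; have := CS_norm (T (adj T xi)) xi.
rewrite (adjP bT) -nsq_dot -l2norm_sqr => H.
have [v0|v0] := eqVneq (l2norm (adj T xi)) 0.
  rewrite v0; have := HM xi; apply: le_trans; exact: l2norm_ge0.
have v1 : 0 < l2norm (adj T xi) by rewrite lt_def v0 l2norm_ge0.
rewrite -(ler_pM2r v1) -expr2; apply: le_trans H _; rewrite mulrAC.
by rewrite ler_wpM2r ?l2norm_ge0.
Qed.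

Lemma bop_adj T : bounded_operator T -> bounded_operator (adj T).
Proof.
move=> bT; split=> [a xi eta|].
  by apply: dot_ext => z; rewrite -(adjP bT) !dotDr !dotZr -!(adjP bT).
by have [M [_ HM]] := bop_bound bT; exists M; apply: adj_bound.
Qed.

End Adjoint.

(** * The diagonal embedding *)

Section GroupAdjoint.
Variables (R : realType) (G : groupType).
Local Notation LG := (range (@lambda R G)).

Lemma commutant_adj (U : operator R G) : commutant LG U -> commutant LG (adj U).
Proof.
move=> [bU HU]; split=> [|_ [s _ <-]]; first exact: bop_adj.
apply/funext => xi /=; apply: dot_ext => z.
rewrite -(adjP bU) -[s in RHS]invgK -dot_lambda -(adjP bU) -{1}[s]invgK -dot_lambda.
have rs : LG (@lambda R G s^-1%g) by exists s^-1%g.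
by have /(congr1 (fun f => f z)) /= -> := HU _ rs.
Qed.

(** The commutant of lambda(G) is stable under adjoints because lambda(G) is, and
    therefore so is the double commutant. *)
Lemma VN_adj (T : operator R G) : VN T -> VN (adj T).
Proof.
move=> [bT HT]; split=> [|U cU]; first exact: bop_adj.
have [bU _] := cU; apply/funext => xi /=; apply: dot_ext => z.
rewrite -(adjP bT) -(adjP' bU) -(adjP' bU) -(adjP bT).
by have /(congr1 (fun f => f z)) /= <- := HT _ (commutant_adj cU).
Qed.

Lemma diag_subproof (xi : l2 R G) :
  rsummable (fun t => nsq (xi t *: (delta t : l2 R G))).
Proof.
have := abs2_rsummable xi; congr rsummable; apply/funext => t.
by rewrite nsqZ nsq_delta mulr1.
Qed.

(** The isometry that sends delta t to delta (t, t). It intertwines lambda(s) with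
    lambda(s) tensor lambda(s), hence T with Gamma(T). *)
Definition diag (xi : l2 R G) : l2 R (G * G)%type := glue (diag_subproof xi).

Lemma slice_diag xi t : slice (diag xi) t = xi t *: delta t.
Proof. by rewrite slice_glue. Qed.

Lemma diagE xi x y : diag xi (x, y) = xi y * (x == y)%:R.
Proof. by []. Qed.

Lemma dot_diag xi eta : dot (diag xi) (diag eta) = dot xi eta.
Proof.
rewrite dot_slices dotE; congr csum; apply/funext => t.
by rewrite !slice_diag dotZr dot_delta l2ZE deltaE eqxx mulr1 mulrC.
Qed.

Lemma l2norm_diag xi : l2norm (diag xi) = l2norm xi.
Proof. by rewrite !l2normE !nsq_dot dot_diag. Qed.

Lemma swap_diag xi : swap (diag xi) = diag xi.
Proof.
apply: l2_ext => -[x y]; change (diag xi (y, x) = diag xi (x, y)).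
by rewrite !diagE eq_sym; case: eqP => [->|]; rewrite ?mulr0.
Qed.

Lemma tensop_lambda_diag (s : G) xi :
  tensop (lambda s) (lambda s) (diag xi) = diag (lambda s xi).
Proof.
rewrite (tensopE (bop_lambda _ s) (bop_lambda _ s)); apply: l2_ext => -[x y].
change (diag xi (s^-1 * x, s^-1 * y)%g = diag (lambda s xi) (x, y)).
by rewrite !diagE lambdaE (inj_eq (mulgI _)).
Qed.

(** The t-th slice of diag xi is xi t times delta t, and T (delta t) has the same norm for
    all t since T commutes with right translations: on the diagonal the operator
    norm of T is replaced by its L2 norm for the trace. *)
Lemma ampl_diag_norm (T : operator R G) (bT : bounded_operator T) xi :
  (forall t xi, T (rho t xi) = rho t (T xi)) ->
  l2norm (ampl bT (diag xi)) = l2norm (T (delta 1%g)) * l2norm xi.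
Proof.
move=> HT; rewrite !l2normE -sqrtrM ?nsq_ge0//; congr Num.sqrt.
apply: EFin_inj; rewrite -esum_nsq_slice EFinM -(sqnormE xi) /sqnorm -esumZ.
- apply: eq_esum => t _; rewrite slice_ampl slice_diag (bopZ bT) nsqZ mulrC.
  congr ((_ * _)%:E).
  have -> : delta t = rho t^-1%g (delta 1%g) :> l2 R G.
    by rewrite rho_delta invgK mul1g.
  by rewrite HT !nsq_dot dot_rho.
- exact: nsq_ge0.
- by move=> t; apply: abs2_ge0.
Qed.

End GroupAdjoint.

(** * Invertibility of weight inverses *)

Section WeightInverse.
Variables (R : realType) (G : groupType).
Variable Gamma : operator R G -> operator R (G * G)%type.
Hypothesis hGamma : comultiplication Gamma.
Implicit Types (xi eta : l2 R G).

Lemma vector_functional_normal (X : choiceType) (M : set (operator R X))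
    (v w : l2 R X) : normal_functional M (fun U => dot (U v) w).
Proof.
pose F (u : l2 R X) n := if n is 0%N then u else 0.
have FS u : (\esum_(n in [set: nat]) (l2norm (F u n) ^+ 2)%:E < +oo)%E.
  rewrite (@esum_single _ _ _ 0%N) ?ltry//; first by rewrite lee_fin sqr_ge0.
  by move=> [|n]//= _; rewrite l2norm0 expr0n.
exists (F v), (F w); split=> // T _.
by rewrite (@csum_single _ _ _ 0%N)// => -[|n]//= _; rewrite dot0r.
Qed.

(** Both sides are normal functionals of T that agree on the translations. *)
Lemma Gamma_diag (T : operator R G) xi : VN T ->
  dot (Gamma T (diag xi)) (diag xi) = dot (T xi) xi.
Proof.
move=> vT; have [[hcod hlin hcomp hadj hnorm] hl] := hGamma.
apply: (@normal_vector_functional _ _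
  (fun T => dot (Gamma T (diag xi)) (diag xi))) => // [|s].
  exact: (hnorm _ (vector_functional_normal _ _ _)).
by rewrite hl tensop_lambda_diag dot_diag.
Qed.

Variable omega : operator R G.
Hypothesis homega : weight_inverse Gamma omega.

Let vo : VN omega. Proof. by case: homega. Qed.
Let bo : bounded_operator omega := VN_bop vo.
Let os := adj omega.
Let vs : VN os. Proof. exact: VN_adj. Qed.
Let bs : bounded_operator os := VN_bop vs.

(** Compressing the defining inequality of a weight inverse to the diagonal: the right-hand
    side becomes the square of the norm of os xi, because Gamma acts on diagonal vectors
    as the original operator. *)
Lemma weight_diag xi :
  l2norm (ampl bs (ampr bs (diag xi))) <= l2norm (os xi).
Proof.
have [_ hle _ _] := homega.
have ba : bounded_operator (omega \o os) := bop_comp bo bs.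
have va : VN (omega \o os) by exact: VN_comp.
have := hle (diag xi); rewrite Gamma_diag// (tensopE ba ba) lecE => /andP[_].
set v := diag xi; set w := ampl bs (ampr bs v).
have -> : ampl ba \o ampr ba = ampl bo \o ampl bs \o (ampr bo \o ampr bs).
  rewrite -(tensopE ba ba); apply/funext => z.
  rewrite (tensopE ba ba); apply: bop_ext_tens => //.
  - by apply: bop_comp; [apply: bop_ampl|apply: bop_ampr].
  - apply: bop_comp; apply: bop_comp; do ?exact: bop_ampl; exact: bop_ampr.
  - by move=> x y; rewrite /= !ampr_tens !ampl_tens.
have adjo xi' eta' : dot (omega xi') eta' = dot xi' (os eta') by exact: adjP.
rewrite /= (ampl_adj _ bs adjo) [ampl bs (ampr bo _)]ampl_ampr (ampr_adj _ bs adjo).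
rewrite -ampl_ampr -/w -/(os _) adjo -!nsq_dot.
by rewrite l2norm_le ?l2norm_ge0// l2norm_sqr.
Qed.

(** If 1 - r factors through os and r is a contraction with small L2 norm, then
    (1 - r) tensor (1 - r) moves diagonal vectors very little, while it factors through
    os tensor os, which weight_diag controls by os. So os is bounded below. The constant
    1/6 leaves half of the norm after the three error terms are subtracted. *)
Lemma diag_almost_id (r y : operator R G) (K : R) xi :
  bounded_operator r -> bounded_operator y -> 0 <= K ->
  (forall t xi, r (rho t xi) = rho t (r xi)) ->
  (forall xi, l2norm (r xi) <= l2norm xi) ->
  l2norm (r (delta 1%g)) <= 6^-1 ->
  (forall xi, l2norm (y xi) <= K * l2norm xi) ->
  (forall xi, xi - r xi = y (os xi)) ->
  2^-1 * l2norm xi <= K ^+ 2 * l2norm (os xi).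
Proof.
move=> br by_ K0 rrho r1 rd yK zE.
set v := diag xi.
have nv : l2norm v = l2norm xi by exact: l2norm_diag.
(* The three error terms of (1 - r) tensor (1 - r) on the diagonal vector v. *)
have e1 : l2norm (ampl br v) <= 6^-1 * l2norm xi.
  by rewrite ampl_diag_norm// ler_wpM2r ?l2norm_ge0.
have e2 : l2norm (ampr br v) <= 6^-1 * l2norm xi.
  by rewrite /ampr l2norm_swap swap_diag.
have r1' xi' : l2norm (r xi') <= 1 * l2norm xi' by rewrite mul1r.
have e3 : l2norm (ampl br (ampr br v)) <= 6^-1 * l2norm xi.
  apply: le_trans e2; rewrite -[leRHS]mul1r.
  exact: ampl_bound.
pose w := ampr by_ (ampr bs v).
have wE : v - ampr br v = w.
  rewrite /w /ampr swapK -{1}[v]swapK -swapB.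
  by congr swap; apply: slice_ext => j; rewrite sliceB !slice_ampl zE.
have wE2 : w - ampl br w = ampl by_ (ampl bs w).
  by apply: slice_ext => j; rewrite sliceB !slice_ampl zE.
have e4 : l2norm (ampl by_ (ampl bs w)) <= K ^+ 2 * l2norm (os xi).
  rewrite /w [ampl bs (ampr by_ _)]ampl_ampr expr2 -mulrA.
  apply: le_trans (ampl_bound _ K0 yK _) _; rewrite ler_wpM2l//.
  apply: le_trans (ampr_bound _ K0 yK _) _; rewrite ler_wpM2l//.
  exact: weight_diag.
apply: le_trans e4; rewrite -wE2.
have h1 : l2norm w <= l2norm (w - ampl br w) + l2norm (ampl br w).
  by have := l2normD (w - ampl br w) (ampl br w); rewrite subrK.
have h2 : l2norm v <= l2norm w + l2norm (ampr br v).
  by have := l2normD (v - ampr br v) (ampr br v); rewrite subrK wE.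
have h3 : l2norm (ampl br w) <= l2norm (ampl br v) + l2norm (ampl br (ampr br v)).
  rewrite -wE (bopB (bop_ampl _ br)); apply: le_trans (l2normD _ _) _.
  by rewrite l2normN.
move: nv e1 e2 e3 h1 h2 h3.
move: (l2norm _) (l2norm _) (l2norm _) (l2norm _) (l2norm _) (l2norm _) (l2norm _).
move=> *; lra.
Qed.


Let adjo xi eta : dot (omega xi) eta = dot xi (os eta).
Proof. exact: adjP. Qed.

(** For small c > 0 this is a positive contraction, and 1 - relax c is a multiple of
    omega omega*. *)
Definition relax (c : R) : operator R G :=
  fun xi => xi - Complex c 0 *: omega (adj omega xi).

Lemma bop_relax c : bounded_operator (relax c).
Proof.
apply: bop_sub; first exact: bop_id.
exact: (bop_scale (Complex c 0) (bop_comp bo bs)).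
Qed.

Lemma relax_self c xi eta : dot (relax c xi) eta = dot xi (relax c eta).
Proof.
rewrite /relax dotBl dotBr dotZl dotZr -/os adjo.
rewrite (_ : conjc (Complex c 0) = Complex c 0); last by rewrite /= oppr0.
by rewrite -[dot xi (omega _)]conjcK -dotC adjo -dotC.
Qed.

Lemma relax_norm c (M : R) xi : 0 <= c -> c * M ^+ 2 <= 1 ->
  (forall xi, l2norm (omega xi) <= M * l2norm xi) ->
  nsq (relax c xi) <= nsq xi - c * nsq (os xi).
Proof.
move=> c0 cM HM; rewrite /relax nsqB nsqZ dotZr -/os.
have -> : re (conjc (Complex c 0) * dot xi (omega (os xi))) = c * nsq (os xi).
  rewrite reM /= oppr0 oppr0 mul0r addr0; congr (_ * _).
  by rewrite re_dotC adjo -nsq_dot.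
have -> : abs2 (Complex c 0 : R[i]) = c ^+ 2 by rewrite /abs2 /= expr0n addr0.
have : nsq (omega (os xi)) <= M ^+ 2 * nsq (os xi).
  have := HM (os xi); rewrite -ler_sqr ?nnegrE ?l2norm_ge0//; last first.
    by apply: le_trans (HM (os xi)); rewrite l2norm_ge0.
  by rewrite exprMn !l2norm_sqr.
move=> h; have h1 : c ^+ 2 * nsq (omega (os xi)) <= c * nsq (os xi).
  apply: le_trans (ler_wpM2l (sqr_ge0 c) h) _.
  rewrite expr2 -mulrA ler_wpM2l// mulrA -[leRHS]mul1r ler_wpM2r ?nsq_ge0//.
move: h1; move: (nsq _) (nsq _) (c ^+ 2 * _) => *; lra.
Qed.

Lemma iter_relax_self c n xi eta :
  dot (iter n (relax c) xi) eta = dot xi (iter n (relax c) eta).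
Proof.
elim: n xi eta => [//|n IH] xi eta.
by rewrite iterS relax_self IH -iterSr.
Qed.

Lemma relax_rho c t xi : relax c (rho t xi) = rho t (relax c xi).
Proof.
rewrite /relax -/os (VN_rho _ _ vs) (VN_rho _ _ vo).
have [bt _] := rho_commutant R t.
by rewrite (bopB bt) (bopZ bt).
Qed.

Lemma iter_relax_rho c n t xi :
  iter n (relax c) (rho t xi) = rho t (iter n (relax c) xi).
Proof. by elim: n => [//|n IH]; rewrite !iterS IH relax_rho. Qed.

(** 1 - b^n is divisible by 1 - b; here b = relax c, and the quotient absorbs the
    left factor omega. *)
Lemma iter_relax_factor c n : exists y : operator R G, bounded_operator y /\
  forall xi, xi - iter n (relax c) xi = y (os xi).
Proof.
elim: n => [|n [y [by_ yE]]].
  exists (fun=> 0); split=> [|xi]; last by rewrite subrr.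
  split=> [a xi eta|]; first by rewrite scaler0 addr0.
  by exists 0 => xi; rewrite l2norm0 mul0r.
have bst := bop_iter n (bop_relax c).
exists (fun xi => y xi + iter n (relax c) (Complex c 0 *: omega xi)); split.
  apply: bop_add => //; apply: (bop_comp bst).
  exact: bop_scale.
move=> xi; rewrite -yE iterSr {2}/relax (bopB bst).
by rewrite opprB addrA [RHS]addrAC addrAC.
Qed.

(** The squared norms s k of the iterates decrease, and self-adjointness makes the inner
    products of even iterates equal to values of s; so the even iterates form a Cauchy
    sequence. The decrements of s bound os on the iterates, so os kills the limit, which
    vanishes by injectivity of os. *)
Lemma iter_relax_cvg0 c (M : R) xi : 0 < c -> c * M ^+ 2 <= 1 ->
  (forall xi, l2norm (omega xi) <= M * l2norm xi) ->
  forall e : R, 0 < e -> exists n, l2norm (iter n (relax c) xi) <= e.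
Proof.
move=> c0 cM HM e e0; have [_ _ _ injs] := homega.
pose s k := nsq (iter k (relax c) xi).
have sS k : s k.+1 <= s k - c * nsq (os (iter k (relax c) xi)).
  by rewrite /s iterS; apply: relax_norm HM => //; apply: ltW.
have sS' k : s k.+1 <= s k.
  by apply: le_trans (sS k) _; rewrite gerBl mulr_ge0 ?nsq_ge0// ltW.
have s_anti m n : (m <= n)%N -> s n <= s m.
  by apply: (@homo_leq _ s (fun x y => y <= x)) => // y x z h1 h2; apply: le_trans h2 h1.
pose S := [set s k | k in [set: nat]].
have S_inf : has_inf S.
  by split; [exists (s 0%N); exists 0%N|exists 0 => _ [k _ <-]; apply: nsq_ge0].
pose L := inf S.
have Lle k : L <= s k by apply: ge_inf; [case: S_inf|exists k].
have near_L d : 0 < d -> exists N, forall n, (N <= n)%N -> s n <= L + d.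
  move=> d0; have [_ [N _ <-] /ltW sN] := inf_adherent d0 S_inf.
  by exists N => n Nn; apply: le_trans sN; apply: s_anti.
have dotL m n : re (dot (iter m.*2 (relax c) xi) (iter n.*2 (relax c) xi)) = s (m + n)%N.
  rewrite -(addnn m) iterD iter_relax_self -iterD addnC /s nsq_dot.
  rewrite -{1}(addnn n) -addnA iterD -iter_relax_self -iterD.
  by rewrite (addnC n m).
pose u n := iter n.*2 (relax c) xi.
have uC : l2cauchy u.
  move=> d d0; have [N HN] := near_L _ (divr_gt0 (exprn_gt0 2 d0) (ltr0n _ 2)).
  exists N => m n Nm Nn; rewrite l2norm_le ?(ltW d0)// nsqB dotL.
  have lem k : (k <= k.*2)%N by rewrite -addnn leq_addl.
  have := HN m.*2 (leq_trans Nm (lem m)); have := HN n.*2 (leq_trans Nn (lem n)).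
  have := Lle (m + n)%N; rewrite -/(s m.*2) -/(s n.*2).
  by move: (s _) (s _) (s _) => *; lra.
have [eta ueta] := l2_complete uC.
have os_eta : os eta = 0.
  apply: l2norm_eq0; apply/eqP; rewrite eq_le l2norm_ge0 andbT.
  apply: (l2cvg_norm (bop_cvg bs ueta)) => d d0; rewrite add0r.
  have [N HN] := near_L _ (mulr_gt0 c0 (exprn_gt0 2 d0)).
  exists N => n Nn /=; rewrite l2norm_le ?(ltW d0)// -(ler_pM2l c0).
  have nn : (N <= n.*2)%N by rewrite -addnn (leq_trans Nn) ?leq_addl.
  have := HN _ nn; have := sS n.*2; have := Lle n.*2.+1.
  by rewrite -/(u n); lra.
have eta0 : eta = 0 by exact: injs.
have [N HN] := ueta e e0; exists N.*2.
by have := HN N (leqnn N); rewrite eta0 l2normC subr0.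
Qed.

Lemma adj_weight_below : exists2 k : R, 0 < k &
  forall xi, k * l2norm xi <= l2norm (os xi).
Proof.
have [M [M0 HM]] := bop_bound bo.
pose c := (M ^+ 2)^-1; have c0 : 0 < c by rewrite invr_gt0 exprn_gt0.
have cM : c * M ^+ 2 <= 1 by rewrite mulVf// gt_eqF// exprn_gt0.
have six : 0 < 6^-1 :> R by rewrite invr_gt0.
have [n Hn] := iter_relax_cvg0 (delta 1%g) c0 cM HM six.
have [y [by_ yE]] := iter_relax_factor c n.
have [K [K0 HK]] := bop_bound by_.
exists ((K ^+ 2)^-1 * 2^-1); first by rewrite mulr_gt0 ?invr_gt0 ?exprn_gt0.
move=> xi; rewrite -mulrA ler_pdivrMl ?exprn_gt0//.
apply: (diag_almost_id _ (bop_iter n (bop_relax c)) by_ (ltW K0) _ _ Hn HK yE) => //.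
  exact: iter_relax_rho.
move=> {}xi; elim: n {Hn yE} => [//|n IH]; rewrite iterS; apply: le_trans IH.
rewrite l2norm_le ?l2norm_ge0// l2norm_sqr.
apply: le_trans (relax_norm _ (ltW c0) cM HM) _.
by rewrite gerBl mulr_ge0 ?nsq_ge0// ltW.
Qed.

(** omega omega* is bounded below, so its range is closed, and a vector orthogonal to the
    range is killed by os. Hence omega omega* is onto, and so is omega. *)
Lemma weight_invertible : exists2 T : operator R G, VN T &
  (forall xi, omega (T xi) = xi) /\ (forall xi, T (omega xi) = xi).
Proof.
have [k k0 Hk] := adj_weight_below.
have [_ _ inj _] := homega.
pose a xi := omega (os xi).
have ba : bounded_operator a := bop_comp bo bs.
have ak xi : k ^+ 2 * l2norm xi <= l2norm (a xi).
  have [->|x0] := eqVneq (l2norm xi) 0; first by rewrite mulr0 l2norm_ge0.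
  have x1 : 0 < l2norm xi by rewrite lt_def x0 l2norm_ge0.
  rewrite -(ler_pM2r x1); apply: le_trans (CS_norm (a xi) xi).
  rewrite adjo -nsq_dot -l2norm_sqr -mulrA -expr2 -exprMn.
  by rewrite ler_sqr ?nnegrE ?l2norm_ge0 ?mulr_ge0 ?l2norm_ge0 ?(ltW k0).
have k2 : 0 < k ^+ 2 by rewrite exprn_gt0.
pose N := range a.
have N0 : N 0 by exists 0 => //; rewrite (bop0 ba).
have NL c xi eta : N xi -> N eta -> N (c *: xi + eta).
  move=> [x _ <-] [y _ <-]; exists (c *: x + y) => //.
  by rewrite (bopD ba) (bopZ ba).
have Ncl u xi : (forall n, N (u n)) -> l2cvg u xi -> N xi.
  move=> Nu uxi.
  have Nu' n : exists z, a z = u n by case: (Nu n) => z _ <-; exists z.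
  have [z zE] := choice Nu'.
  have zC : l2cauchy z.
    move=> e e0; have e1 : 0 < k ^+ 2 * e / 2 by rewrite divr_gt0// mulr_gt0.
    have [M HM] := uxi _ e1; exists M => m n Mm Mn.
    rewrite -(ler_pM2l k2); apply: le_trans (ak _) _; rewrite (bopB ba) !zE.
    apply: le_trans (l2norm_tri xi _ _) _.
    by have := HM _ Mm; have := HM _ Mn; rewrite (l2normC (u m)); lra.
  have [x zx] := l2_complete zC; exists x => //.
  apply: (l2cvg_unique (bop_cvg ba zx)).
  by move=> e /uxi[M HM]; exists M => n /HM; rewrite /= zE.
have surj xi : exists z, a z = xi.
  have [P [bP NP OP]] := projection N0 NL Ncl.
  suff xiE : xi = P xi by have [z _ zE] := NP xi; exists z; rewrite xiE.
  have : dot (xi - P xi) (a (xi - P xi)) = 0 by apply: OP; exists (xi - P xi).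
  rewrite dotC adjo dot_nsq => /(congr1 (@complex.Re R)) /= /nsq_eq0 os0.
  apply/eqP; rewrite -subr_eq0; apply/eqP; apply: l2norm_eq0; apply/eqP.
  rewrite eq_le l2norm_ge0 andbT -(ler_pM2l k0) mulr0.
  by apply: le_trans (Hk _) _; rewrite os0 l2norm0.
have [T0 T0E] := choice surj; pose T := os \o T0.
have TE xi : omega (T xi) = xi by exact: T0E.
(* The inverse T is linear and commutes with the commutant because omega does and is
   injective; it is bounded because omega omega* is bounded below. *)
have omega_inj xi eta : omega xi = omega eta -> xi = eta.
  move=> E; apply/eqP; rewrite -subr_eq0; apply/eqP; apply: inj.
  by rewrite (bopB bo) E subrr.
have ET xi : T (omega xi) = xi by apply: omega_inj; rewrite TE.
exists T => //; split.
  split=> [c xi eta|]; first by apply: omega_inj; rewrite (bopD bo) (bopZ bo) !TE.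
  have [M [M0 HM]] := bop_bound bs.
  exists (M / k ^+ 2) => xi.
  apply: le_trans (HM (T0 xi)) _; rewrite -mulrA ler_wpM2l ?(ltW M0)//.
  by rewrite ler_pdivlMl// -{2}[xi]T0E; apply: ak.
move=> U cU; have [_ HU] := vo; apply/funext => xi; apply: omega_inj => /=.
by rewrite TE -{1}[xi]TE -[RHS]/((omega \o U) (T xi)) HU.
Qed.

End WeightInverse.

(** * The Fourier algebra and its characters *)

Section FourierAlgebra.
Variables (R : realType) (G : groupType).
Implicit Types (xi eta zeta : l2 R G) (T : operator R G).

Lemma coeffE xi eta s : coeff xi eta s = dot (lambda s xi) eta. Proof. by []. Qed.

(** Two vector functionals that agree on the translations agree on VN(G), so the choice of
    the representing vectors in the definition of the pairing is immaterial. *)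
Lemma pairing_coeff T xi eta : VN T -> pairing T (coeff xi eta) = dot (T xi) eta.
Proof.
move=> vT; rewrite /pairing.
case: xgetP => [z _ [x [y [E ->]]]|/(_ (dot (T xi) eta)) H]; last first.
  by exfalso; apply: H; exists xi, eta.
apply: (@normal_vector_functional _ _ (fun T => dot (T x) y)) => //.
  exact: vector_functional_normal.
by move=> s; rewrite -!coeffE E.
Qed.

Lemma dual_act_coeff T xi eta : VN T ->
  dual_act T (coeff xi eta) = coeff (T xi) eta.
Proof.
move=> vT; rewrite /dual_act.
case: xgetP => [g _ [[x [y ->]] H]|/(_ (coeff (T xi) eta)) H].
  apply/funext => s; rewrite !coeffE -(pairing_coeff _ _ (VN_lambda _ s)).
  by rewrite H ?pairing_coeff//; [apply: VN_comp => //|]; apply: VN_lambda.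
exfalso; apply: H; split; first by exists (T xi), eta.
by move=> S vS; rewrite !pairing_coeff//; apply: VN_comp.
Qed.

Lemma coeff_linear a xi xi' eta :
  coeff (a *: xi + xi') eta = a *: coeff xi eta + coeff xi' eta.
Proof.
apply/funext => s; rewrite coeffE (bopD (bop_lambda _ s)) (bopZ (bop_lambda _ s)).
by rewrite dotDl dotZl.
Qed.

Lemma coeff_conj_linear a xi eta eta' :
  coeff xi (a *: eta + eta') = conjc a *: coeff xi eta + coeff xi eta'.
Proof. by apply/funext => s; rewrite coeffE dotDr dotZr. Qed.

Lemma coeff_delta (s t : G) :
  coeff (delta s) (delta t) = (fun g => (t == g * s)%g%:R) :> (G -> R[i]).
Proof. by apply/funext => g; rewrite coeffE lambda_delta dot_delta deltaE. Qed.

Lemma fourier_norm_le xi eta : fourier_norm (coeff xi eta) <= l2norm xi * l2norm eta.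
Proof.
apply: ge_inf; last by exists xi, eta.
by exists 0 => _ [x [y [_ ->]]]; rewrite mulr_ge0 ?l2norm_ge0.
Qed.

End FourierAlgebra.

Section Characters.
Variables (R : realType) (G : groupType).
Variables (omega T : operator R G).
Hypotheses (vo : VN omega) (vT : VN T).
Hypothesis oT : forall xi, omega (T xi) = xi.
Hypothesis To : forall xi, T (omega xi) = xi.
Implicit Types (xi eta zeta : l2 R G).

Let bo : bounded_operator omega := VN_bop vo.
Let bT : bounded_operator T := VN_bop vT.

(** As omega is onto, A(G, omega) contains every coefficient function. *)
Lemma coeff_beurling xi eta : beurling omega (coeff xi eta).
Proof.
by exists (coeff (T xi) eta); [exists (T xi), eta|rewrite dual_act_coeff// oT].
Qed.

Definition beurling_elt xi eta : beurling omega := SigSub (mem_set (coeff_beurling xi eta)).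

Lemma val_beurling_elt xi eta : val (beurling_elt xi eta) = coeff xi eta. Proof. by []. Qed.

Lemma beurling_eltP (f : beurling omega) : exists xi eta, f = beurling_elt xi eta.
Proof.
have := set_valP f => -[_ [x [y ->]] E].
by exists (omega x), y; apply: val_inj; rewrite /= -E dual_act_coeff.
Qed.

Lemma dual_act_inj u v : fourier u -> fourier v ->
  dual_act omega u = dual_act omega v -> u = v.
Proof.
move=> [x [y ->]] [x' [y' ->]]; rewrite !dual_act_coeff// => E.
apply/funext => s; have vs : VN (lambda s \o T) by apply: VN_comp => //; apply: VN_lambda.
have := congr1 (pairing (lambda s \o T)) E.
by rewrite !pairing_coeff// /= !To.
Qed.

Lemma beurling_normE u : fourier u ->
  beurling_norm omega (dual_act omega u) = fourier_norm u.
Proof.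
move=> Fu; rewrite /beurling_norm; congr fourier_norm.
by case: xgetP => [v _ [Fv /dual_act_inj]|/(_ u)]; [apply|case].
Qed.

Lemma beurling_norm_le xi eta :
  beurling_norm omega (coeff xi eta) <= l2norm (T xi) * l2norm eta.
Proof.
have Fu : fourier (coeff (T xi) eta) by exists (T xi), eta.
by rewrite -{1}[xi]oT -dual_act_coeff// beurling_normE// fourier_norm_le.
Qed.

Lemma represents_eval s : represents (lambda s \o omega) (eval_char omega s).
Proof.
move=> _ f [x [y ->]]; rewrite dual_act_coeff// /eval_char => ->.
by rewrite pairing_coeff//; apply: VN_comp => //; apply: VN_lambda.
Qed.

Lemma eval_is_character s : gelfand_spectrum omega (eval_char omega s).
Proof.
split; rewrite /eval_char.
- by move=> a f g h ->.
- by move=> f g h ->.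
- have [M [M0 HM]] := bop_bound bo; exists M => f.
  have [xi [eta ->]] := beurling_eltP f; rewrite val_beurling_elt.
  pose u := coeff (T xi) eta; have Fu : fourier u by exists (T xi), eta.
  have uE : dual_act omega u = coeff xi eta by rewrite dual_act_coeff// oT.
  rewrite -uE beurling_normE// -ler_pdivrMl//.
  apply: lb_le_inf; first by exists (l2norm (T xi) * l2norm eta), (T xi), eta.
  move=> _ [x [y [E ->]]]; rewrite ler_pdivrMl// E dual_act_coeff// coeffE.
  apply: le_trans (CS _ _) _; rewrite l2norm_lambda mulrA.
  by rewrite ler_wpM2r ?l2norm_ge0.
- exists (beurling_elt (delta 1%g) (delta s)).
  by rewrite val_beurling_elt coeff_delta mulg1 eqxx oner_neq0.
Qed.

Lemma eval_char_inj s t : eval_char omega s = eval_char omega t -> s = t.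
Proof.
move=> /(congr1 (fun chi => chi (beurling_elt (delta 1%g) (delta s)))).
rewrite /eval_char val_beurling_elt coeff_delta !mulg1 eqxx; case: eqP => // _ /eqP.
by rewrite oner_eq0.
Qed.

(** The point masses are the coefficients of delta 1 and delta s. If chi vanished on all of
    them, it would vanish on the coefficients of all pairs of point masses, hence on A(G) by
    continuity in each vector. At a point mass on which chi is nonzero, multiplicativity
    applied to f times that point mass, a multiple of it, determines chi f. *)
Lemma character_eval chi : gelfand_spectrum omega chi ->
  exists s, chi = eval_char omega s.
Proof.
move=> [chiL chiM [M HM] [f0 f0P]].
have eltL a xi xi' eta :
    chi (beurling_elt (a *: xi + xi') eta) = a * chi (beurling_elt xi eta) + chi (beurling_elt xi' eta).
  by apply: chiL; rewrite !val_beurling_elt coeff_linear.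
have eltC a xi eta eta' : chi (beurling_elt xi (a *: eta + eta')) =
    conjc a * chi (beurling_elt xi eta) + chi (beurling_elt xi eta').
  by apply: chiL; rewrite !val_beurling_elt coeff_conj_linear.
have [C [C0 HC]] := bop_bound bT.
have chi_le xi eta : cabs (chi (beurling_elt xi eta)) <= `|M| * C * l2norm xi * l2norm eta.
  apply: le_trans (HM _) _; rewrite val_beurling_elt.
  have N0 : 0 <= beurling_norm omega (coeff xi eta).
    have [u Fu <-] := coeff_beurling xi eta; rewrite beurling_normE//.
    have [x [y uE]] := Fu; apply: lb_le_inf.
      by exists (l2norm x * l2norm y), x, y.
    by move=> _ [x' [y' [_ ->]]]; rewrite mulr_ge0 ?l2norm_ge0.
  apply: le_trans (ler_wpM2r N0 (ler_norm M)) _.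
  rewrite -!mulrA ler_wpM2l// mulrA; apply: le_trans (beurling_norm_le _ _) _.
  by rewrite ler_wpM2r ?l2norm_ge0.
have [s es] : exists s, chi (beurling_elt (delta 1%g) (delta s)) != 0.
  apply: contrapT => H; have chi_e s : chi (beurling_elt (delta 1%g) (delta s)) = 0.
    by apply: contrapT => /eqP e; apply: H; exists s.
  (* The coefficient of two point masses is again a point mass of G. *)
  have chi_d s t : chi (beurling_elt (delta s) (delta t)) = 0.
    rewrite -(chi_e (t * s^-1)%g); congr chi; apply: val_inj.
    rewrite !val_beurling_elt !coeff_delta; apply/funext => g; congr (nat_of_bool _)%:R.
    by rewrite mulg1; apply/eqP/eqP => [->|<-]; rewrite ?mulgK ?mulgVK.
  have chi_de s eta : chi (beurling_elt (delta s) eta) = 0.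
    rewrite -[LHS]conjcK.
    rewrite (@bounded_functional0 _ _ (fun eta => conjc (chi (beurling_elt (delta s) eta)))
      (`|M| * C)) ?conjc0//.
    - by move=> a x y; rewrite eltC rmorphD rmorphM /= conjcK.
    - move=> x; rewrite /cabs abs2J; apply: le_trans (chi_le _ _) _.
      by rewrite l2norm_delta mulr1.
    - by move=> x; rewrite chi_d conjc0.
  have [x [y f0E]] := beurling_eltP f0.
  move: f0P; rewrite f0E (@bounded_functional0 _ _ (fun x => chi (beurling_elt x y))
    (`|M| * C * l2norm y)) ?eqxx// => z.
  by apply: le_trans (chi_le _ _) _; rewrite mulrAC.
exists s; apply/funext => f; rewrite /eval_char.
have e0 : chi (beurling_elt 0 (delta s)) = 0.
  have := eltL (-1) 0 0 (delta s); rewrite scaler0 addr0 mulN1r addNr; exact.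
have : chi (beurling_elt (val f s *: delta 1%g + 0) (delta s)) =
    chi f * chi (beurling_elt (delta 1%g) (delta s)).
  apply: chiM; rewrite addr0 !val_beurling_elt; apply/funext => g.
  change (coeff (val f s *: delta 1%g) (delta s) g =
    val f g * coeff (delta 1%g) (delta s) g).
  rewrite coeffE (bopZ (bop_lambda _ g)) dotZl -coeffE coeff_delta mulg1.
  by case: eqP => [->//|]; rewrite !mulr0.
by rewrite eltL e0 addr0 => /(mulIf es).
Qed.

End Characters.

Theorem corollary4p19 (R : realType) (G : groupType)
    (Gamma : operator R G -> operator R (G * G)%type)
    (hGamma : comultiplication Gamma)
    (omega : operator R G) (homega : weight_inverse Gamma omega) :
  [/\ set_bij [set: G]%classic (spec omega) (fun s : G => lambda s \o omega),
      set_bij [set: G]%classic (gelfand_spectrum omega)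
        (eval_char omega) &
      forall s : G, represents (lambda s \o omega) (eval_char omega s)].
Proof.
have [T vT [oT To]] := weight_invertible hGamma homega.
have [vo _ _ _] := homega.
have rep s := @represents_eval R G omega vo s.
have vlo s : VN (lambda s \o omega) by apply: VN_comp => //; apply: VN_lambda.
have charE s := eval_is_character vo vT oT To s.
split=> //; split.
- move=> s _; split; first exact: vlo.
  by exists (eval_char omega s).
- move=> s t _ _ E.
  have : lambda s (omega (T (delta 1%g))) s = lambda t (omega (T (delta 1%g))) s.
    exact: (congr1 (fun S : operator R G => l2fun (S (T (delta 1%g))) s) E).
  rewrite !oT !lambda_delta !deltaE !mulg1 eqxx; case: eqP => // _ /eqP.
  by rewrite oner_eq0.
- move=> sigma [vS [chi chiS chiR]].
  have [s chiE] := character_eval vo vT oT To chiS.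
  exists s => //; apply/funext => xi; apply: l2_ext => t.
  rewrite -!dot_delta.
  rewrite -(pairing_coeff xi (delta t) (vlo s)) -(pairing_coeff xi (delta t) vS).
  set u := coeff xi (delta t); have Fu : fourier u by exists xi, (delta t).
  have Bu : beurling omega (dual_act omega u) by exists u.
  pose f : beurling omega := SigSub (mem_set Bu).
  by rewrite -(rep s u f Fu)// -(chiR u f Fu)// chiE.
- by move=> s _; apply: charE.
- by move=> s t _ _; apply: (eval_char_inj vo oT).
- move=> chi chiS; have [s ->] := character_eval vo vT oT To chiS.
  by exists s.
Qed.
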